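(* Consider the Wishart case described in the context, with $n\ge2$. Let $p\in(2,+\infty]$ and assume that $f\in L^p(\Omega)$ and $\rho(\bar\beta)\in L^p(\Omega)$. Then $\mathrm{Tr}(\mathrm{Cov}(\beta))<+\infty$ (convergence of the algorithm) holds if $$m>n+\frac{p+2}{p-2}.$$ In the case where $\rho(\bar\beta)\in L^\infty(\Omega)$ (that is, $p=\infty$), this condition corresponds to $m\ge n+2$, and the computational cost of the algorithm is bounded by $$C\varepsilon^{-2}\,\frac{n^3m^4\log n}{(m-n+1)(m-n-1)}\,\|\rho(\bar\beta)\|_{L^\infty}^2,$$ where $\varepsilon$ is the required precision and the constant $C$ is independent of $n$ and $m$. The optimal value $m^*$ of $m$ in the previous bound (the value $m\ge n+2$ minimizing the factor $\frac{m^4}{(m-n+1)(m-n-1)}$) satisfies $m^*\sim2n$ when $n\to+\infty$, and the corresponding computational cost is bounded by $$C'\varepsilon^{-2}\,n^5\log n\,\|\rho(\bar\beta)\|_{L^\infty}^2$$ with $C'$ independent of $n$. In addition, for this choice of $m$, the consistency error is bounded as $$\|\bar\beta-\alpha\|_2\le C''\,n\,\|\rho(\alpha)\|_{L^\infty}$$ with $C''$ independent of $n$.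
   Context: Wishart case: $\Omega=\mathbb{R}^n$, $\mu$ is the standard Gaussian measure $d\mu(x)=(2\pi)^{-n/2}e^{-\|x\|_2^2/2}dx$, and $\gamma_j(x)=x_j$ for $j=1,\dots,n$; $f:\mathbb{R}^n\to\mathbb{R}$ is measurable. For $a\in\mathbb{R}^n$ the residue is $\rho(a)(x)=f(x)-\sum_{j=1}^na_jx_j$. $X^{(1)},\dots,X^{(m)}$ ($m\ge n$) are i.i.d. with distribution $\mu$, $F(X)=(f(X^{(1)}),\dots,f(X^{(m)}))^T$, and $\Gamma(X)$ is the $m\times n$ matrix with entries $\Gamma_{ij}(X)=\gamma_j(X^{(i)})=X^{(i)}_j$ (i.i.d. standard Gaussian entries), so $\Gamma(X)^T\Gamma(X)$ is a.s. invertible. Put $\beta=(\Gamma(X)^T\Gamma(X))^{-1}\Gamma(X)^TF(X)\in\mathbb{R}^n$, $\bar\beta=\mathbb{E}\beta$, $\mathrm{Cov}(\beta)=\mathbb{E}[(\beta-\bar\beta)(\beta-\bar\beta)^T]$. $\alpha$ is the $L^2(\Omega)$ least-squares solution, i.e. the minimizer of $\|\rho(a)\|_{L^2(\Omega)}^2$ over $a\in\mathbb{R}^n$. For $p=\infty$, $\frac{p+2}{p-2}$ is read as $1$. Computational cost: the algorithm approximates $\bar\beta$ by the Monte Carlo average $\frac1N\sum_{i=1}^N\beta_i$ of i.i.d. copies of $\beta$. For a fixed confidence level $\eta\in(0,1)$, let $x(n,\eta)>0$ solve $\frac{1}{\sqrt{2\pi}}\int_{x(n,\eta)}^{+\infty}e^{-u^2/2}du=\frac{\eta}{2n}$.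 The Euclidean diameter of the (asymptotic level $\eta$) product confidence region is bounded by $2x(n,\eta)\sqrt{\mathrm{Tr}(\mathrm{Cov}(\beta))/N}$, so that precision $\varepsilon$ requires $N=4x(n,\eta)^2\varepsilon^{-2}\mathrm{Tr}(\mathrm{Cov}(\beta))$ draws; each draw costs of the order $n^2m$ operations. The computational cost is $N$ times the cost of one draw, i.e. a constant times $n^2m\cdot 4x(n,\eta)^2\varepsilon^{-2}\mathrm{Tr}(\mathrm{Cov}(\beta))$. The constants $C,C',C''$ do not depend on $f$, $\varepsilon$, and $C,C'$ may depend on $\eta$. *)

(* Defs.v *)
From HB Require Import structures.
From mathcomp Require Import all_boot all_order all_algebra.
From mathcomp Require Import all_classical all_reals all_analysis.
From mathcomp Require Import measurable_realfun.

Set Implicit Arguments.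
Unset Strict Implicit.
Unset Printing Implicit Defensive.
Import Order.TTheory GRing.Theory Num.Theory.
Import numFieldNormedType.Exports.
Local Open Scope classical_set_scope.
Local Open Scope ereal_scope.
Local Open Scope ring_scope.

(* R^n is represented as a space carrying measures by n.-tuple R (with the
   product sigma-algebra), and as a space of parameters and in linear algebra
   by 'cV[R]_n. *)

Section cons_measure.
Context {R : realType} (n : nat).

Definition tcons (p : measurableTypeR R * n.-tuple R) : n.+1.-tuple R := [tuple of p.1 :: p.2].

Lemma measurable_tcons : measurable_fun setT tcons.
Proof. exact: (measurable_cons measurable_fst measurable_snd). Qed.

HB.instance Definition _ := isMeasurableFun.Build _ _ _ _ tcons measurable_tcons.

Variable mu : {sigma_finite_measure set (n.-tuple R) -> \bar R}.

Definition cons_measure : set (n.+1.-tuple R) -> \bar R :=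
  pushforward (@lebesgue_measure R \x mu)%E tcons.

Let cons_measure0 : cons_measure set0 = 0%E.
Proof. by rewrite /cons_measure /pushforward preimage_set0 measure0. Qed.

Let cons_measure_ge0 A : (0 <= cons_measure A)%E.
Proof. by rewrite /cons_measure /pushforward measure_ge0. Qed.

Let cons_measure_sigma_additive : semi_sigma_additive cons_measure.
Proof.
move=> F mF tF mUF; rewrite /cons_measure /pushforward preimage_bigcup.
apply: measure_semi_sigma_additive.
- by move=> k; rewrite -[X in measurable X]setTI; exact: measurable_tcons.
- apply/trivIsetP => /= i j _ _ ij; rewrite -preimage_setI.
  by move/trivIsetP : tF => /(_ _ _ _ _ ij) ->//; rewrite preimage_set0.
- by rewrite -preimage_bigcup -[X in measurable X]setTI; exact: measurable_tcons.
Qed.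

HB.instance Definition _ := isMeasure.Build _ _ _ cons_measure
  cons_measure0 cons_measure_ge0 cons_measure_sigma_additive.

Let uncons (x : n.+1.-tuple R) : measurableTypeR R * n.-tuple R :=
  (tnth x ord0, [tuple of behead x]).

Let measurable_uncons : measurable_fun setT uncons.
Proof.
by apply/measurable_fun_pairP; split; [exact: measurable_tnth|exact: measurable_behead].
Qed.

Let tconsK : cancel tcons uncons.
Proof. by case=> x y; congr pair; exact: val_inj. Qed.

Let cons_measure_sigma_finite : sigma_finite setT cons_measure.
Proof.
have /sigma_finiteP[F [TF ndF Foo]] := sigma_finiteT (@lebesgue_measure R).
have /sigma_finiteP[G [TG ndG Goo]] := sigma_finiteT mu.
have mFG k : measurable (F k `*` G k).
  by apply: measurableX; [case: (Foo k)|case: (Goo k)].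
exists (fun k => uncons @^-1` (F k `*` G k)).
  rewrite -preimage_bigcup; apply/esym; rewrite -subTset => x _ /=.
  have [i _ Fi] : (\bigcup_i F i) (uncons x).1 by rewrite -TF.
  have [j _ Gj] : (\bigcup_i G i) (uncons x).2 by rewrite -TG.
  exists (maxn i j) => //; split.
    by move: Fi; exact/subsetPset/ndF/leq_maxl.
  by move: Gj; exact/subsetPset/ndG/leq_maxr.
move=> k; split.
  by rewrite -[X in measurable X]setTI; exact: measurable_uncons.
rewrite /cons_measure /pushforward -comp_preimage.
rewrite (_ : uncons \o tcons = id) ?preimage_id; last exact/funext/tconsK.
have [mF F_oo] := Foo k; have [mG G_oo] := Goo k.
by rewrite product_measure1E// lte_mul_pinfty// ge0_fin_numE.
Qed.

HB.instance Definition _ := Measure_isSigmaFinite.Build _ _ _ cons_measure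
  cons_measure_sigma_finite.

End cons_measure.

(* n-dimensional Lebesgue measure, as an iterated product. *)
Fixpoint lebesgue_tuple {R : realType} (n : nat) :
    {sigma_finite_measure set (n.-tuple R) -> \bar R} :=
  match n with
  | 0 => @dirac _ (0.-tuple R) [tuple] R
  | k.+1 => cons_measure (lebesgue_tuple k)
  end.

Section gaussian.
Context {R : realType} (n : nat).

Definition gaussian_density (x : n.-tuple R) : R :=
  (2 * pi) `^ (- (n%:R / 2)) * expR (- (\sum_(j < n) tnth x j ^+ 2) / 2).

Lemma gaussian_density_ge0 x : 0 <= gaussian_density x.
Proof. by rewrite mulr_ge0 ?powR_ge0 ?expR_ge0. Qed.

Lemma measurable_gaussian_density : measurable_fun setT gaussian_density.
Proof.
apply: measurable_funM => //; apply: measurableT_comp => //.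
apply: measurable_funM => //; apply: measurableT_comp => //.
apply: measurable_sum => j; apply: measurable_funX.
exact: measurable_tnth.
Qed.

Definition gaussian_measure (A : set (n.-tuple R)) : \bar R :=
  (\int[lebesgue_tuple n]_(x in A) (gaussian_density x)%:E)%E.

Let gaussian_measure0 : gaussian_measure set0 = 0%E.
Proof. by rewrite /gaussian_measure integral_set0. Qed.

Let gaussian_measure_ge0 A : (0 <= gaussian_measure A)%E.
Proof. by apply: integral_ge0 => x _; rewrite lee_fin gaussian_density_ge0. Qed.

Let gaussian_measure_sigma_additive : semi_sigma_additive gaussian_measure.
Proof.
move=> A mA tA mUA.
have f0 x : (0 <= (gaussian_density x)%:E)%E.
  by rewrite lee_fin gaussian_density_ge0.
have mf D : measurable_fun D (fun x => (gaussian_density x)%:E).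
  apply: measurable_funTS.
  by apply/measurable_EFinP; exact: measurable_gaussian_density.
rewrite /gaussian_measure ge0_integral_bigcup//=.
apply: is_cvg_ereal_nneg_natsum_cond => k _ _.
exact: integral_ge0.
Qed.

HB.instance Definition _ := isMeasure.Build _ _ _ gaussian_measure
  gaussian_measure0 gaussian_measure_ge0 gaussian_measure_sigma_additive.

End gaussian.

Arguments gaussian_measure {R} n.

Definition l2norm (R : realType) (n : nat) (v : 'cV[R]_n) : R :=
  Num.sqrt (\sum_(j < n) v j 0 ^+ 2).

Definition residue (R : realType) (n : nat) (f : n.-tuple R -> R)
    (a : 'cV[R]_n) (x : n.-tuple R) : R :=
  f x - \sum_(j < n) a j 0 * tnth x j.

Definition least_squares (R : realType) (n : nat) (f : n.-tuple R -> R)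
    (alpha : 'cV[R]_n) : Prop :=
  forall a : 'cV[R]_n,
    ('N[gaussian_measure n]_2%:E[EFin \o residue f alpha] ^+ 2 <=
     'N[gaussian_measure n]_2%:E[EFin \o residue f a] ^+ 2)%E.

Definition mutually_independent (R : realType) (d d' : measure_display)
    (T : measurableType d) (T' : measurableType d') (P : probability T R)
    (I : finType) (X : I -> {RV P >-> T'}) : Prop :=
  forall (J : {set I}) (A : I -> set T'), (forall i, measurable (A i)) ->
    P (\bigcap_(i in [set` J]) (X i @^-1` A i)) =
    (\prod_(i in J) P (X i @^-1` A i))%E.

Definition iid_gaussian (R : realType) (d : measure_display)
    (T : measurableType d) (P : probability T R) (n m : nat)
    (X : 'I_m -> {RV P >-> n.-tuple R}) : Prop :=
  mutually_independent X /\
  forall (i : 'I_m) (A : set (n.-tuple R)), measurable A ->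
    distribution P (X i) A = gaussian_measure n A.

Section regression.
Context {R : realType} {d : measure_display} {T : measurableType d}.
Context {P : probability T R} {n m : nat}.
Variables (X : 'I_m -> {RV P >-> n.-tuple R}) (f : n.-tuple R -> R).

Definition Gamma_mx (w : T) : 'M[R]_(m, n) :=
  \matrix_(i < m, j < n) tnth (X i w) j.

Definition F_vec (w : T) : 'cV[R]_m := \col_(i < m) f (X i w).

(* invmx is the identity on singular matrices; Gamma^T Gamma is almost surely
   invertible when n <= m. *)
Definition beta (w : T) : 'cV[R]_n :=
  invmx ((Gamma_mx w)^T *m Gamma_mx w) *m (Gamma_mx w)^T *m F_vec w.

Definition beta_bar : 'cV[R]_n :=
  \col_(j < n) fine 'E_P[fun w => beta w j 0].

(* Entries are extended reals, so that an infinite trace is expressible.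
   covariance centres at fine 'E_P[_], i.e. at beta_bar, hence the diagonal
   entry j is the integral of the nonnegative function
   (beta j - beta_bar j)^2, and a finite trace entails that beta is square
   integrable. *)
Definition Cov_beta : 'M[\bar R]_n :=
  \matrix_(j < n, k < n)
    covariance P (fun w => beta w j 0) (fun w => beta w k 0).

Definition TrCov : \bar R := \tr Cov_beta.

(* Cost with precision eps: N = 4 x^2 eps^-2 TrCov draws, each of cost
   kappa * n^2 * m. *)
Definition cost (kappa x eps : R) : \bar R :=
  ((kappa * (n%:R ^+ 2 * m%:R))%:E * ((4 * x ^+ 2 * eps ^- 2)%:E * TrCov))%E.

End regression.

Definition confidence_threshold (R : realType) (n : nat) (eta x : R) : Prop :=
  0 < x /\
  ((Num.sqrt (2 * pi))^-1%:E *
    \int[lebesgue_measure]_(u in `[x, +oo[) (expR (- (u ^+ 2 / 2)))%:E)%E =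
  (eta / (2 * n%:R))%:E.

(* (p + 2) / (p - 2), read as 1 at p = +oo; the value at -oo is irrelevant. *)
Definition exponent_ratio (R : realType) (p : \bar R) : R :=
  if p is r%:E then (r + 2) / (r - 2) else 1.

Definition sample_factor (R : realType) (n m : nat) : R :=
  m%:R ^+ 4 / ((m%:R - n%:R + 1) * (m%:R - n%:R - 1)).

Definition optimal_sample_size (R : realType) (n m : nat) : Prop :=
  (n.+2 <= m)%N /\
  forall k : nat, (n.+2 <= k)%N -> sample_factor R n m <= sample_factor R n k.

Definition wishart_setting (R : realType) (d : measure_display)
    (T : measurableType d) (P : probability T R) (n m : nat)
    (X : 'I_m -> {RV P >-> n.-tuple R}) (f : n.-tuple R -> R) (p : \bar R) :
    Prop :=
  [/\ (2 <= n)%N, (n <= m)%N, iid_gaussian X, (2%:E < p)%E &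
      f \in Lfun (gaussian_measure n) p /\
      residue f (beta_bar X f) \in Lfun (gaussian_measure n) p].

(* Main.v *)
Require Import Defs.
From HB Require Import structures.
From mathcomp Require Import all_boot all_order all_algebra.
From mathcomp Require Import fingroup perm ring lra.
From mathcomp Require Import all_classical all_reals all_analysis.
From mathcomp Require Import measurable_realfun ess_sup_inf.

Set Implicit Arguments.
Unset Strict Implicit.
Unset Printing Implicit Defensive.
Import Order.TTheory GRing.Theory Num.Theory.
Import numFieldNormedType.Exports.
Local Open Scope classical_set_scope.
Local Open Scope ring_scope.

(** Write [G] for the matrix [Gamma_mx X w], [W] for the inverse of [G^T *m G],
    and [r] for the vector of the residues [residue f a] at the sample points.
    When [G^T *m G] is invertible, [beta - a = W *m G^T *m r], and the squared
    norm of the row [j] of [W *m G^T] is [W j j]; by the Cauchy-Schwarz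
    inequality the square of [beta j - a j] is at most [W j j] times the squared
    norm of [r] ([sqr_beta_sub_le]).  Every bound of the theorem therefore
    comes from the moments of the diagonal entries of [W].

    The inverse of [W j j] is the squared distance [D] from the column [j] of
    [G] to the span of the [n - 1] other columns.  These columns are independent
    standard Gaussian vectors of [R^m] ([distribution_flat_tuple]), so that,
    given the other columns, [D] is the value at a standard Gaussian vector of
    the quadratic form of an orthogonal projection of rank [k = m - n + 1].
    Its Laplace transform is [(1 + 2 * s) ^ (- k / 2)], by the Gaussian integral
    of a quadratic form ([integral_stdgauss_quad]) and the determinant
    [det_1Dcoproj].  Letting [s] tend to infinity shows that [D] almost surely
    does not vanish, hence, by induction on the number of columns, that
    [G^T *m G] is almost surely invertible ([det_gram_neq0]).  Taking [s] among
    the powers of [2] bounds the moment of order [q] of [W j j] as soon as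
    [2 * q < k] ([integral_gram_inv_powR]).  For [q = 1] and [n + 2 <= m] the
    bound can be taken independent of [n] and [m], since [k] is at least [3].

    For [p] finite, Young's inequality with exponents [p / (p - 2)] and [p / 2]
    separates [W j j] from the residues, and the moment of order [p / (p - 2)]
    is finite under the assumed bound on [m] ([TrCov_lty]).  For bounded
    residues, the squared norm of [r] is at most [m] times the square of the
    essential supremum, so that the trace of the covariance is
    [O(n * m)] times this square, and the mean error in each coordinate is
    [O(Num.sqrt m)] times the essential supremum.  The cost bound follows from
    [x ^+ 2 = O(ln n)] ([confidence_threshold_sqr_le]) and from
    [m ^+ 2 <= sample_factor R n m]; the bounds for the optimal [m] follow from
    the value of the factor at [2 * n], from [m <= 5 * n], and from the fact
    that the optimal [m] is within [4] of [2 * n]. *)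

(** * Standard Gaussian measure on tuples *)

(** Integration against a measure with density [g], from the uniqueness of the
    Radon-Nikodym derivative. *)
Lemma ge0_integral_density d (T : measurableType d) (R : realType)
    (mu : {sigma_finite_measure set T -> \bar R}) (nu : probability T R)
    (g : T -> R) (f : T -> \bar R) :
  measurable_fun setT g -> (forall x, 0 <= g x) ->
  (forall A, measurable A -> nu A = \int[mu]_(x in A) (g x)%:E)%E ->
  measurable_fun setT f -> (forall x, 0 <= f x)%E ->
  (\int[nu]_x f x = \int[mu]_x (f x * (g x)%:E))%E.
Proof.
move=> mg g0 nuE mf f0.
have numu : nu `<< mu.
  apply/null_content_dominatesP => A mA muA; rewrite nuE//.
  apply: null_set_integral => //; apply/measurable_EFinP.
  exact: measurable_funTS.
rewrite -(Radon_Nikodym_SigmaFinite.change_of_variables numu)//.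
have mh := measurable_int mu (Radon_Nikodym_SigmaFinite.f_integrable numu).
apply: ge0_ae_eq_integral => //.
- exact: emeasurable_funM.
- by apply: emeasurable_funM => //; exact/measurable_EFinP.
- by move=> x _; rewrite mule_ge0// Radon_Nikodym_SigmaFinite.f_ge0.
- by move=> x _; rewrite mule_ge0// lee_fin.
have : ae_eq mu setT (Radon_Nikodym_SigmaFinite.f nu mu) (EFin \o g).
  apply: integral_ae_eq => //.
  - exact: Radon_Nikodym_SigmaFinite.f_integrable.
  - exact/measurable_EFinP.
  - move=> E _ mE; rewrite -nuE//.
    by rewrite -Radon_Nikodym_SigmaFinite.f_integral.
by apply: filterS => x /= + _ => ->.
Qed.

(** The Gaussian measure as an iterated product of one-dimensional normal
    probabilities: unlike [gaussian_measure], it carries by construction the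
    structure of a probability and obeys Tonelli's theorem one coordinate at a
    time. *)
Fixpoint stdgauss {R : realType} (N : nat) : probability (N.-tuple R) R :=
  match N with
  | 0 => @dirac _ (0.-tuple R) [tuple] R
  | k.+1 => distribution (normal_prob 0 1 \x stdgauss k)%E (@tcons R k)
  end.

Section stdgauss_theory.
Context {R : realType}.
Implicit Types N : nat.

Lemma integral_stdgaussS N (h : N.+1.-tuple R -> \bar R) :
  measurable_fun setT h -> (forall x, 0 <= h x)%E ->
  (\int[stdgauss N.+1]_x h x =
   \int[normal_prob 0 1]_t \int[stdgauss N]_x h (tcons (t, x)))%E.
Proof.
move=> mh h0; rewrite /= ge0_integral_distribution// fubini_tonelli1//.
- exact: measurableT_comp.
- by move=> x; exact: h0.
Qed.

Lemma integral_stdgaussS_swap N (h : N.+1.-tuple R -> \bar R) :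
  measurable_fun setT h -> (forall x, 0 <= h x)%E ->
  (\int[stdgauss N.+1]_x h x =
   \int[stdgauss N]_x \int[normal_prob 0 1]_t h (tcons (t, x)))%E.
Proof.
move=> mh h0; rewrite /= ge0_integral_distribution// fubini_tonelli2//.
- exact: measurableT_comp.
- by move=> x; exact: h0.
Qed.

Lemma normal_pdf01E (x : R) :
  normal_pdf 0 1 x = (Num.sqrt (2 * pi))^-1 * expR (- (x ^+ 2 / 2)).
Proof.
rewrite normal_pdfE ?oner_neq0// /normal_peak /normal_fun expr1n mul1r.
by rewrite subr0 mulNr -mulr_natl.
Qed.

Lemma ge0_integral_normal_prob (m s : R) (h : R -> \bar R) :
  measurable_fun setT h -> (forall x, 0 <= h x)%E ->
  (\int[normal_prob m s]_x h x =
   \int[lebesgue_measure]_x (h x * (normal_pdf m s x)%:E))%E.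
Proof.
move=> mh h0; apply: ge0_integral_density => //.
- exact: measurable_normal_pdf.
- exact: normal_pdf_ge0.
Qed.

Lemma measurable_rect N (B : 'I_N -> set R) : (forall i, measurable (B i)) ->
  measurable [set x : N.-tuple R | forall i, B i (tnth x i)].
Proof.
move=> mB; rewrite (_ : mkset _ =
    \bigcap_(i in [set: 'I_N]) ((@tnth N R)^~ i @^-1` B i)); last first.
  by apply/seteqP; split => x /= xB i => [_|]; exact: xB.
apply: fin_bigcap_measurable => [|i _]; first exact: finite_finset.
by rewrite -[X in measurable X]setTI; exact: measurable_tnth.
Qed.

Lemma stdgauss_rect N (B : 'I_N -> set R) : (forall i, measurable (B i)) ->
  stdgauss N [set x | forall i, B i (tnth x i)] =
  (\prod_(i < N) normal_prob 0 1 (B i))%E.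
Proof.
elim: N B => [|N IH] B mB.
  by rewrite big_ord0 /= diracE mem_set//=; case.
pose B' (i : 'I_N) := B (lift ord0 i).
rewrite big_ord_recl -(IH B'); last by move=> i; exact: mB.
transitivity ((normal_prob 0 1 \x stdgauss N)%E
    (B ord0 `*` [set x | forall i, B' i (tnth x i)])); last first.
  have mB' := @measurable_rect N B' (fun i => mB _).
  exact: (@product_measure1E _ _ _ _ R (normal_prob 0 1) (stdgauss N) (B ord0) _ (mB _) mB').
rewrite /= /distribution /pushforward; congr ((_ \x _)%E _).
apply/seteqP; split.
  case=> t x /= Btx; split => [|i]; first exact: (Btx ord0).
  by have := Btx (lift ord0 i); rewrite (tnth_nth 0)/= -tnth_nth.
case=> t x /= [Bt Bx] i.
case: (unliftP ord0 i) => [j ->|->]; last exact: Bt.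
by rewrite (tnth_nth 0)/= -tnth_nth; exact: Bx.
Qed.

(** Rectangles are stable under intersection and generate the product
    sigma-algebra, so they determine a finite measure. *)
Lemma distribution_stdgauss d (T : measurableType d) (P : probability T R) N
    (Y : {RV P >-> N.-tuple R}) :
  (forall B : 'I_N -> set R, (forall i, measurable (B i)) ->
    P [set w | forall i, B i (tnth (Y w) i)] =
    (\prod_(i < N) normal_prob 0 1 (B i))%E) ->
  forall A, measurable A -> distribution P Y A = stdgauss N A.
Proof.
move=> PY.
pose G := [set A | exists2 B : 'I_N -> set R, (forall i, measurable (B i)) &
  A = [set x : N.-tuple R | forall i, B i (tnth x i)]].
apply: (measure_unique G (fun=> setT)).
- apply/seteqP; split.
    apply: smallest_sub; first exact: smallest_sigma_algebra.
    rewrite -bigcup_seq => A [i _ [B mB <-]]; apply: sub_sigma_algebra.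
    exists (fun j => if j == i then B else setT) => [j|]; first by case: ifP.
    rewrite setTI; apply/seteqP; split => x /=.
      by move=> Bx j; case: eqP => // ->.
    by move=> /(_ i); rewrite eqxx.
  apply: smallest_sub; first exact: sigma_algebra_measurable.
  by move=> _ [B mB ->]; exact: measurable_rect.
- move=> _ _ [B mB ->] [C mC ->]; exists (fun i => B i `&` C i) => [i|].
    exact: measurableI.
  apply/seteqP; split => x /=; first by move=> [Bx Cx] i; split.
  by move=> BC; split => i; case: (BC i).
- by move=> _; exists (fun=> setT) => //; apply/seteqP; split.
- by rewrite bigcup_const.
- by move=> _ [B mB ->]; exact: (etrans (PY B mB) (esym (stdgauss_rect mB))).
- by move=> _; rewrite (le_lt_trans (probability_le1 _ _))// ltry.
Qed.

End stdgauss_theory.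

Section gaussian_measure_stdgauss.
Context {R : realType}.

Lemma gaussian_densityS N (t : R) (x : N.-tuple R) :
  gaussian_density (tcons (t, x)) = gaussian_density x * normal_pdf 0 1 t.
Proof.
rewrite normal_pdf01E /gaussian_density big_ord_recl.
have pi2 : 0 < 2 * pi :> R by rewrite mulr_gt0// pi_gt0.
have -> : (2 * pi) `^ (- (N.+1%:R / 2)) =
    (2 * pi) `^ (- (N%:R / 2)) * (Num.sqrt (2 * pi))^-1 :> R.
  rewrite -[N.+1%:R]natr1 (mulrDl N%:R) opprD powRD; last by rewrite (gt_eqF pi2) implybT.
  by rewrite mul1r (powRN _ 2^-1) powR12_sqrt// ltW.
have -> : \sum_(i < N) tnth (tcons (t, x)) (lift ord0 i) ^+ 2 =
    \sum_(j < N) tnth x j ^+ 2.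
  by apply: eq_bigr => i _; rewrite (tnth_nth 0)/= -tnth_nth.
rewrite (_ : tnth (tcons (t, x)) ord0 = t)// mulrACA -expRD.
by congr (_ * expR _); field.
Qed.

Lemma integral_stdgaussE N (h : N.-tuple R -> \bar R) :
  measurable_fun setT h -> (forall x, 0 <= h x)%E ->
  (\int[stdgauss N]_x h x =
   \int[lebesgue_tuple N]_x (h x * (gaussian_density x)%:E))%E.
Proof.
elim: N h => [|N IH] h mh h0.
  have mg := @measurable_gaussian_density R 0.
  rewrite /= !integral_dirac//; last first.
    by apply: emeasurable_funM => //; exact/measurable_EFinP.
  rewrite /gaussian_density big_ord0 !(oppr0, mul0r) powRr0 expR0.
  by rewrite mulr1 mule1.
have mg := @measurable_gaussian_density R N.+1.
have mhg : measurable_fun setT (fun x => h x * (gaussian_density x)%:E)%E.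
  by apply: emeasurable_funM => //; exact/measurable_EFinP.
have hg0 x : (0 <= h x * (gaussian_density x)%:E)%E.
  by rewrite mule_ge0// lee_fin gaussian_density_ge0.
rewrite integral_stdgaussS//.
rewrite [RHS](ge0_integral_pushforward (@measurable_tcons R N))//=.
rewrite preimage_setT fubini_tonelli1//=; last first.
  exact: (measurableT_comp mhg (@measurable_tcons R N)).
have mhc := measurableT_comp mh (@measurable_tcons R N).
have mht t : measurable_fun setT (fun x : N.-tuple R => h (tcons (t, x))).
  exact: (measurableT_comp mhc (pair1_measurable t)).
rewrite ge0_integral_normal_prob//; last 2 first.
- apply: (measurable_fun_fubini_tonelli_F (m2 := stdgauss N)
    (h \o @tcons R N)) => // x; exact: h0.
- by move=> t; exact: integral_ge0.
apply: eq_integral => t _; rewrite IH//.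
have mgN := @measurable_gaussian_density R N.
rewrite -ge0_integralZr//; last 3 first.
- by apply: emeasurable_funM => //; exact/measurable_EFinP.
- by move=> x _; rewrite mule_ge0// lee_fin gaussian_density_ge0.
- by rewrite lee_fin normal_pdf_ge0.
apply: eq_integral => x _.
by rewrite gaussian_densityS (EFinM (gaussian_density x)) muleA.
Qed.

Lemma gaussian_measure_stdgauss N (A : set (N.-tuple R)) : measurable A ->
  gaussian_measure N A = stdgauss N A.
Proof.
move=> mA; rewrite /gaussian_measure integral_mkcond.
transitivity (\int[stdgauss N]_x (\1_A x)%:E)%E; last first.
  by rewrite integral_indic// setIT.
rewrite integral_stdgaussE//; last exact/measurable_EFinP/measurable_indic.
apply: eq_integral => x _.
rewrite patchE indicE; case: ifPn => _ /=; first by rewrite mul1e.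
by rewrite mul0e.
Qed.

End gaussian_measure_stdgauss.

Section stdgauss_cat.
Context {R : realType}.

Definition tcat m k (p : m.-tuple R * k.-tuple R) : (m + k).-tuple R :=
  [tuple of p.1 ++ p.2].

Lemma measurable_tcat m k : measurable_fun setT (@tcat m k).
Proof.
apply/measurable_fun_tnthP => i; rewrite /comp /tcat.
case: (fintype.splitP i) => j ij.
  rewrite (_ : (fun _ => _) = fun p : m.-tuple R * k.-tuple R => tnth p.1 j).
    exact: (measurableT_comp (measurable_tnth j) measurable_fst).
  by apply/funext => p; rewrite !(tnth_nth 0)/= nth_cat size_tuple ij ltn_ord.
rewrite (_ : (fun _ => _) = fun p : m.-tuple R * k.-tuple R => tnth p.2 j).
  exact: (measurableT_comp (measurable_tnth j) measurable_snd).
apply/funext => p; rewrite !(tnth_nth 0)/= nth_cat size_tuple ij.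
by rewrite ltnNge leq_addr/= addKn.
Qed.

(** A Gaussian tuple splits into two independent Gaussian tuples. *)
Lemma integral_stdgauss_cat m k (h : (m + k).-tuple R -> \bar R) :
  measurable_fun setT h -> (forall x, 0 <= h x)%E ->
  (\int[stdgauss (m + k)]_z h z =
   \int[stdgauss k]_y \int[stdgauss m]_x h (tcat (x, y)))%E.
Proof.
elim: m h => [|m IH] h mh h0.
  apply: eq_integral => y _; rewrite integral_dirac//.
  - by rewrite diracE mem_set// mul1e; congr h; exact: val_inj.
  - exact: (measurableT_comp (measurableT_comp mh (@measurable_tcat 0 k))
      (pair2_measurable y)).
have mht t : measurable_fun setT (fun z : (m + k).-tuple R => h (tcons (t, z))).
  exact: (measurableT_comp (measurableT_comp mh (@measurable_tcons R (m + k)))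
    (pair1_measurable t)).
rewrite [LHS](@integral_stdgaussS R (m + k))//.
under eq_integral do rewrite IH//.
pose H (q : (measurableTypeR R * k.-tuple R) * m.-tuple R) :=
  h (tcons (q.1.1, tcat (q.2, q.1.2))).
have mH : measurable_fun setT H.
  apply: (measurableT_comp (measurableT_comp mh (@measurable_tcons R (m + k)))).
  apply: measurable_fun_pair => /=.
    by apply: measurableT_comp.
  apply: (measurableT_comp (@measurable_tcat m k)).
  by apply: measurable_fun_pair => //; exact: measurableT_comp.
have H0 q : (0 <= H q)%E by exact: h0.
have mF := measurable_fun_fubini_tonelli_F (m2 := stdgauss m) H mH H0.
transitivity (\int[normal_prob 0 1]_t \int[stdgauss k]_y
    fubini_F (stdgauss m) H (t, y))%E; first by [].
rewrite (fubini_tonelli (m1 := normal_prob 0 1) (m2 := stdgauss k)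
  (fubini_F (stdgauss m) H))//; last first.
  by move=> q; apply: integral_ge0 => x _; exact: H0.
apply: eq_integral => y _; rewrite [RHS]integral_stdgaussS//.
  apply: eq_integral => t _; apply: eq_integral => x _.
  by rewrite /H/=; congr h; exact: val_inj.
exact: (measurableT_comp (measurableT_comp mh (@measurable_tcat m.+1 k))
      (pair2_measurable y)).
Qed.

End stdgauss_cat.

(** * Gaussian integrals of quadratic forms *)

Section gaussian_quadratic_form.
Context {R : realType}.

(** Completing the square, the integrand times the standard normal density is a
    multiple of the normal density of mean [- (b / a)] and variance [a^-1]. *)
Lemma integral_normal_quadratic (a b : R) : 0 < a ->
  (\int[normal_prob 0 1]_t (expR (- ((a - 1) * t ^+ 2 + 2 * b * t) / 2))%:E =
   ((Num.sqrt a)^-1 * expR (b ^+ 2 / a / 2))%:E)%E.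
Proof.
move=> a0; have sa0 : 0 < Num.sqrt a by rewrite sqrtr_gt0.
have s0 : (Num.sqrt a)^-1 != 0 by rewrite invr_neq0// gt_eqF.
rewrite ge0_integral_normal_prob//; last first.
  apply/measurable_EFinP; apply: measurableT_comp => //.
  apply: measurable_funM => //; apply: measurableT_comp => //.
  by apply: measurable_funD => //; apply: measurable_funM.
under eq_integral => t _.
  rewrite -EFinM normal_pdf01E.
  rewrite (_ : expR _ * (_ * expR _) = ((Num.sqrt a)^-1 * expR (b ^+ 2 / a / 2)) *
     normal_pdf (- (b / a)) (Num.sqrt a)^-1 t); last first.
    rewrite normal_pdfE// /normal_peak /normal_fun exprVn sqr_sqrtr ?ltW//.
    rewrite [LHS]mulrCA [RHS]mulrACA -!expRD -[RHS]mulrA.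
    have -> : Num.sqrt (a^-1 * pi *+ 2) = (Num.sqrt a)^-1 * Num.sqrt (2 * pi).
      by rewrite -sqrtrV ?ltW// -sqrtrM ?invr_ge0 ?ltW// -mulr_natl mulrCA.
    rewrite invfM invrK [RHS]mulrA mulKf ?gt_eqF//; congr (_ * expR _).
    by field; rewrite gt_eqF.
  rewrite EFinM.
  over.
rewrite ge0_integralZl//.
- by rewrite integral_normal_pdf// mule1.
- by apply/measurable_EFinP; exact: measurable_normal_pdf.
- by move=> t _; rewrite lee_fin normal_pdf_ge0.
Qed.

Definition quad m (S : 'M[R]_m) (v : 'rV[R]_m) : R := (v *m S *m v^T) 0 0.

Definition posdef m (S : 'M[R]_m) : Prop :=
  S^T = S /\ forall v : 'rV[R]_m, v != 0 -> 0 < quad S v.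

Definition row_of_tuple m (x : m.-tuple R) : 'rV[R]_m := \row_i tnth x i.

Lemma measurable_quad m (S : 'M[R]_m) :
  measurable_fun setT (fun x => quad S (row_of_tuple x)).
Proof.
rewrite (_ : (fun _ => _) = fun x : m.-tuple R =>
    \sum_i ((\sum_j tnth x j * S j i) * tnth x i)).
  apply: measurable_sum => i; apply: measurable_funM.
    apply: measurable_sum => j; apply: measurable_funM => //.
    exact: measurable_tnth.
  exact: measurable_tnth.
apply/funext => x; rewrite /quad mxE; apply: eq_bigr => i _.
by rewrite !mxE; congr (_ * _); apply: eq_bigr => j _; rewrite mxE.
Qed.

Lemma measurable_expR_quad m (S : 'M[R]_m) :
  measurable_fun setT (fun x => expR (- quad S (row_of_tuple x) / 2)).
Proof.
apply: measurableT_comp => //; apply: measurable_funM => //.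
by apply: measurableT_comp => //; exact: measurable_quad.
Qed.

Lemma row_of_tcons m (t : R) (x : m.-tuple R) :
  row_of_tuple (tcons (t, x)) = row_mx (t%:M : 'M[R]_1) (row_of_tuple x).
Proof.
apply/rowP => i; rewrite !mxE; case: fintype.splitP => j ij.
  by rewrite !mxE !ord1 (tnth_nth 0) ij ord1.
by rewrite !mxE !(tnth_nth 0)/= ij.
Qed.

(** Singles out the first coordinate [t], in which the form is a quadratic
    polynomial. *)
Lemma quad_block m (a : R) (b : 'rV[R]_m) (S : 'M[R]_m) (t : R) (v : 'rV_m) :
  quad (block_mx (a%:M : 'M[R]_1) b b^T S) (row_mx (t%:M : 'M[R]_1) v) =
  a * t ^+ 2 + 2 * (b *m v^T) 0 0 * t + quad S v.
Proof.
have dotC : (v *m b^T) 0 0 = (b *m v^T) 0 0.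
  by rewrite -[in LHS](trmxK v) -trmx_mul mxE.
rewrite /quad mul_row_block tr_row_mx mul_row_col tr_scalar_mx mul_mx_scalar.
rewrite !mul_scalar_mx mulmxDl -scalemxAl.
have E (A B : 'M[R]_1) : (A + B) 0 0 = A 0 0 + B 0 0 by rewrite mxE.
have Z (A : 'M[R]_1) (c : R) : (c *: A) 0 0 = c * A 0 0 by rewrite mxE.
rewrite !(E, Z) dotC mxE mulr1n; ring.
Qed.

(** Completing the square in the first coordinate leaves the form of the Schur
    complement in the others. *)
Lemma quad_schur m (a : R) (b : 'rV[R]_m) (S : 'M[R]_m) (v : 'rV_m) :
  quad (S - a^-1 *: (b^T *m b)) v = quad S v - (b *m v^T) 0 0 ^+ 2 / a.
Proof.
have dotC : (v *m b^T) 0 0 = (b *m v^T) 0 0.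
  by rewrite -[in LHS](trmxK v) -trmx_mul mxE.
rewrite /quad mulmxBr mulmxBl -scalemxAr -scalemxAl.
rewrite mulmxA -mulmxA [v *m b^T]mx11_scalar mul_scalar_mx dotC -scalemxAl.
by move: (b *m _) (v *m _) => B N; rewrite !mxE; ring.
Qed.

(** One column elimination, by a unipotent block matrix. *)
Lemma det_schur m (a : R) (b : 'rV[R]_m) (S : 'M[R]_m) : a != 0 ->
  \det (block_mx (a%:M : 'M[R]_1) b b^T S) = a * \det (S - a^-1 *: (b^T *m b)).
Proof.
move=> a0.
pose L : 'M[R]_(1 + m) := block_mx 1%:M (- a^-1 *: b) 0 1%:M.
have <- : \det (block_mx (a%:M : 'M[R]_1) b b^T S *m L) =
    \det (block_mx (a%:M : 'M[R]_1) b b^T S).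
  by rewrite det_mulmx /L det_ublock !det1 !mulr1.
rewrite /L mulmx_block !mulmx1 !mulmx0 !addr0 mul_scalar_mx scalerA mulrN.
rewrite divff// scaleN1r addNr det_lblock det_scalar expr1.
by rewrite -scalemxAr scaleNr addrC.
Qed.

Lemma posdef_block m (a : R) (b : 'rV[R]_m) (S : 'M[R]_m) :
  posdef (block_mx (a%:M : 'M[R]_1) b b^T S) ->
  0 < a /\ posdef (S - a^-1 *: (b^T *m b)).
Proof.
move=> [sym pos].
have a0 : 0 < a.
  have := pos (row_mx 1%:M 0); rewrite quad_block expr1n mulr1 trmx0 mulmx0.
  rewrite /quad !mul0mx !mxE mulr0 mul0r !addr0; apply.
  apply/eqP => /(congr1 (fun M : 'rV_(1 + m) => M 0 (lshift m 0))).
  by rewrite row_mxEl !mxE; apply/eqP; rewrite oner_eq0.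
split => //; split.
  move: sym; rewrite tr_block_mx => /eq_block_mx[_ _ _ SS].
  by rewrite linearB linearZ/= trmx_mul trmxK SS.
move=> v v0; set c := (b *m v^T) 0 0.
have := pos (row_mx (- c / a)%:M v); rewrite quad_block quad_schur -/c.
rewrite (_ : a * _ + _ = - (c ^+ 2 / a)); last by field; rewrite gt_eqF.
rewrite addrC; apply.
apply/eqP => /(congr1 rsubmx); rewrite row_mxKr linear0.
exact/eqP.
Qed.

(** Integrating out the first coordinate by [integral_normal_quadratic]
    multiplies by the inverse square root of the corner entry and replaces the
    matrix by its Schur complement, whose determinant is the remaining factor
    of the determinant. *)
Lemma integral_stdgauss_quad m (S : 'M[R]_m) : posdef S ->
  0 < \det S /\
  (\int[stdgauss m]_x (expR (- quad (S - 1%:M) (row_of_tuple x) / 2))%:E =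
   ((Num.sqrt (\det S))^-1)%:E)%E.
Proof.
elim: m S => [|m IH] S pS.
  rewrite det_mx00 ltr01 sqrtr1 invr1; split => //.
  rewrite integral_dirac//.
    by rewrite /quad mxE big_ord0 oppr0 mul0r expR0 diracE mem_set// mule1.
  apply/measurable_EFinP. exact: measurable_expR_quad.
have [a [b [S' SE]]] : exists a, exists b, exists S' : 'M[R]_m,
    S = block_mx (a%:M : 'M[R]_1) b b^T S' :> 'M[R]_(1 + m).
  exists (S 0 0), (ursubmx (S : 'M[R]_(1 + m))), (drsubmx (S : 'M[R]_(1 + m))).
  rewrite -[LHS](@submxK _ 1 m 1 m); congr block_mx.
    by apply/matrixP => i j; rewrite !ord1 !mxE; congr (S _ _); exact: val_inj.
  by rewrite trmx_ursub (proj1 pS).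
have [a0 pS'] := posdef_block (eq_ind _ (@posdef (1 + m)) pS _ SE).
have [d0 intS'] := IH _ pS'.
have detS : \det S = a * \det (S' - a^-1 *: (b^T *m b)).
  by rewrite -det_schur ?gt_eqF// -SE.
split; first by rewrite detS mulr_gt0.
have mq : measurable_fun setT (fun x : m.+1.-tuple R =>
    expR (- quad (S - 1%:M) (row_of_tuple x) / 2)).
  apply: measurableT_comp => //; apply: measurable_funM => //.
  by apply: measurableT_comp => //; exact: measurable_quad.
rewrite integral_stdgaussS_swap//; last first.
  by apply/measurable_EFinP; exact: measurable_expR_quad.
transitivity (\int[stdgauss m]_x (((Num.sqrt a)^-1)%:E *
    (expR (- quad (S' - a^-1 *: (b^T *m b) - 1%:M) (row_of_tuple x) / 2))%:E))%E.
  apply: eq_integral => x _.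
  set v := row_of_tuple x.
  transitivity (\int[normal_prob 0 1]_t
      ((expR (- ((a - 1) * t ^+ 2 + 2 * (b *m v^T) 0 0 * t) / 2))%:E *
       (expR (- quad (S' - 1%:M) v / 2))%:E))%E.
    apply: eq_integral => t _; rewrite row_of_tcons -/v SE.
    have -> : block_mx (a%:M : 'M[R]_1) b b^T S' - 1%:M =
        block_mx ((a - 1)%:M : 'M[R]_1) b b^T (S' - 1%:M).
      have E1 : (1%:M : 'M[R]_(1 + m)) = block_mx 1%:M 0 0 1%:M.
        exact: scalar_mx_block.
      rewrite [X in _ - X]E1 opp_block_mx add_block_mx !oppr0 !addr0.
      by rewrite raddfB.
    by rewrite quad_block -EFinM -expRD; congr (expR _)%:E; ring.
  rewrite ge0_integralZr//; last first.
    apply/measurable_EFinP; apply: measurableT_comp => //.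
    apply: measurable_funM => //; apply: measurableT_comp => //.
    by apply: measurable_funD => //; apply: measurable_funM.
  rewrite integral_normal_quadratic// -!EFinM; congr EFin.
  rewrite -[LHS]mulrA -expRD.
  congr (_ * expR _); rewrite addrAC quad_schur; ring.
rewrite ge0_integralZl// ?intS'.
  by rewrite -EFinM detS sqrtrM ?ltW// invfM.
apply/measurable_EFinP; exact: measurable_expR_quad.
Qed.

End gaussian_quadratic_form.

(** * Gram matrices and projections *)

Section gram.
Context {R : realType}.

(** Sylvester's identity: both sides are the determinant of a block matrix with
    identity diagonal blocks, reduced by one elimination or the other. *)
Lemma det_1BmulmxC m n (U : 'M[R]_(m, n)) (V : 'M[R]_(n, m)) :
  \det (1%:M - U *m V) = \det (1%:M - V *m U).
Proof.
pose M : 'M[R]_(n + m) := block_mx 1%:M V U 1%:M.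
pose L : 'M[R]_(n + m) := block_mx 1%:M (- V) 0 1%:M.
have dL : \det L = 1 by rewrite /L det_ublock !det1 mulr1.
have -> : \det (1%:M - U *m V) = \det (M *m L).
  rewrite /M /L mulmx_block !mulmx1 !mulmx0 !mul1mx !addr0 mulmxN addNr.
  by rewrite det_lblock det1 mul1r addrC.
have -> : \det (1%:M - V *m U) = \det (L *m M).
  rewrite /M /L mulmx_block !mulmx1 !mul1mx !mul0mx !add0r mulNmx subrr.
  by rewrite det_lblock det1 mulr1.
by rewrite !det_mulmx mulrC.
Qed.

Definition gram n m (G : 'M[R]_(n, m)) : 'M[R]_n := G *m G^T.

(** Orthogonal projection, acting on row vectors, onto the complement of the
    row space of [G]. *)
Definition coproj n m (G : 'M[R]_(n, m)) : 'M[R]_m :=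
  1%:M - G^T *m invmx (gram G) *m G.

Lemma tr_gram n m (G : 'M[R]_(n, m)) : (gram G)^T = gram G.
Proof. by rewrite /gram trmx_mul trmxK. Qed.

Lemma tr_invmx_gram n m (G : 'M[R]_(n, m)) :
  (invmx (gram G))^T = invmx (gram G).
Proof. by rewrite trmx_inv tr_gram. Qed.

Lemma tr_coproj n m (G : 'M[R]_(n, m)) : (coproj G)^T = coproj G.
Proof.
by rewrite /coproj linearB/= trmx1 !trmx_mul trmxK tr_invmx_gram mulmxA.
Qed.

Lemma coproj_idem n m (G : 'M[R]_(n, m)) : gram G \in unitmx ->
  coproj G *m coproj G = coproj G.
Proof.
move=> uG; rewrite {1}/coproj mulmxBl mul1mx.
suff -> : G^T *m invmx (gram G) *m G *m coproj G = 0 by rewrite subr0.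
rewrite /coproj mulmxBr mulmx1 -!mulmxA [G *m (G^T *m _)]mulmxA -/(gram G).
by rewrite mulKVmx// subrr.
Qed.

Lemma mulmx_tr_ge0 m (v : 'rV[R]_m) : 0 <= (v *m v^T) 0 0.
Proof. by rewrite mxE sumr_ge0// => i _; rewrite mxE -expr2 sqr_ge0. Qed.

Lemma mulmx_tr_gt0 m (v : 'rV[R]_m) : v != 0 -> 0 < (v *m v^T) 0 0.
Proof.
move=> v0; rewrite lt_neqAle mulmx_tr_ge0 andbT eq_sym.
apply: contra v0; rewrite mxE psumr_eq0 => [/allP v0|i _]; last first.
  by rewrite mxE -expr2 sqr_ge0.
apply/eqP/rowP => i; have := v0 i (mem_index_enum _).
by rewrite mxE -expr2 sqrf_eq0 mxE => /eqP.
Qed.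

Lemma quad_coproj_ge0 n m (G : 'M[R]_(n, m)) (v : 'rV[R]_m) :
  gram G \in unitmx -> 0 <= quad (coproj G) v.
Proof.
move=> uG; rewrite /quad -(coproj_idem uG) -{2}tr_coproj mulmxA -mulmxA.
by rewrite -trmx_mul mulmx_tr_ge0.
Qed.

Lemma posdef_1Dcoproj n m (G : 'M[R]_(n, m)) (s : R) :
  gram G \in unitmx -> 0 <= s -> posdef (1%:M + s *: coproj G).
Proof.
move=> uG s0; split; first by rewrite linearD linearZ/= trmx1 tr_coproj.
move=> v v0; rewrite /quad mulmxDr mulmxDl mulmx1 -scalemxAr -scalemxAl !mxE.
rewrite ltr_wpDr//; last by have := mulmx_tr_gt0 v0; rewrite mxE.
by have := quad_coproj_ge0 v uG; rewrite /quad mxE; exact: mulr_ge0.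
Qed.

(** The eigenvalues of [1 + s *: coproj G] are [1] on the row space of [G] and
    [1 + s] on its complement, which has dimension [m - n]. *)
Lemma det_1Dcoproj n m (G : 'M[R]_(n, m)) (s : R) : (n <= m)%N ->
  gram G \in unitmx -> 0 <= s ->
  \det (1%:M + s *: coproj G) = (1 + s) ^+ (m - n).
Proof.
move=> nm uG s0; have s1 : 1 + s != 0 by rewrite gt_eqF// ltr_pwDl.
pose c := s / (1 + s).
have -> : 1%:M + s *: coproj G =
    (1 + s) *: (1%:M - (c *: (G^T *m invmx (gram G))) *m G).
  rewrite /coproj scalerBr scalerBr -scalemxAl scalerA /c mulrC divfK//.
  by rewrite addrA scalerDl scale1r.
rewrite detZ det_1BmulmxC -scalemxAr mulmxA -/(gram G) mulmxV//.
rewrite -[X in X - c *: _]scale1r -scalerBl detZ det1 mulr1.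
have -> : 1 - c = (1 + s)^-1 by rewrite /c; field.
by rewrite exprVn expfB_cond ?(negPf s1).
Qed.

Lemma gram_col_mx n m (g : 'rV[R]_m) (G : 'M[R]_(n, m)) :
  gram (col_mx g G) = block_mx (g *m g^T) (g *m G^T) (G *m g^T) (gram G).
Proof. by rewrite /gram tr_col_mx mul_col_row. Qed.

(** Adding a row multiplies the Gram determinant by the squared distance from
    this row to the span of the others. *)
Lemma det_gram_col_mx n m (g : 'rV[R]_m) (G : 'M[R]_(n, m)) :
  gram G \in unitmx ->
  \det (gram (col_mx g G)) = quad (coproj G) g * \det (gram G).
Proof.
move=> uG.
pose L : 'M[R]_(1 + n) := block_mx 1%:M 0 (- (invmx (gram G) *m G *m g^T)) 1%:M.
have <- : \det (gram (col_mx g G) *m L) = \det (gram (col_mx g G)).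
  by rewrite det_mulmx /L det_lblock !det1 !mulr1.
rewrite gram_col_mx /L mulmx_block !mulmx1 !mulmx0 !add0r.
have -> : G *m g^T + gram G *m - (invmx (gram G) *m G *m g^T) = 0.
  by rewrite mulmxN !mulmxA mulmxV// mul1mx subrr.
rewrite det_ublock; congr (_ * _).
rewrite det_mx11 /quad /coproj mulmxBr mulmx1 mulmxBl mulmxN.
by rewrite !mulmxA.
Qed.

(** Cramer's rule; together with [det_gram_col_mx], the corner entry is the
    inverse of the squared distance from [g] to the row space of [G]. *)
Lemma invmx_gram00 n m (g : 'rV[R]_m) (G : 'M[R]_(n, m)) :
  gram (col_mx g G) \in unitmx ->
  invmx (gram (col_mx g G)) 0 0 = \det (gram G) / \det (gram (col_mx g G)).
Proof.
move=> u; rewrite /invmx u !mxE mulrC; congr (_ / _).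
rewrite /cofactor expr0 mul1r; congr (\det _).
apply/matrixP => i j; rewrite !mxE; apply: eq_bigr => k _; rewrite !mxE.
have L (l : 'I_n) : lift 0 l = rshift 1 l by exact: val_inj.
by rewrite !L !(unsplitK (inr _)).
Qed.

End gram.

(** * Measurability of matrix operations *)

Section measurable_matrix.
Context d {T : measurableType d} {R : realType}.

(** The convention [0^-1 = 0] is respected by writing the inverse of [y] as
    [y] times the power of exponent [-1] of its square. *)
Lemma measurable_funVr (f : T -> R) : measurable_fun setT f ->
  measurable_fun setT (fun x => (f x)^-1).
Proof.
move=> mf; rewrite (_ : (fun _ => _) = fun x => f x * (f x ^+ 2) `^ (-1)).
  apply: measurable_funM => //.
  have m2 : measurable_fun setT (fun x => f x ^+ 2) by exact: measurable_funX.
  exact: (measurableT_comp (@measurable_powR R (-1)) m2).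
apply/funext => x; rewrite powR_inv1 ?sqr_ge0//.
have [->|fx0] := eqVneq (f x) 0; first by rewrite invr0 mul0r.
by rewrite expr2 invfM mulrA divff// mul1r.
Qed.

Definition measurable_mx m n (M : T -> 'M[R]_(m, n)) : Prop :=
  forall i j, measurable_fun setT (fun x => M x i j).

Lemma measurable_mulmx m n p (A : T -> 'M[R]_(m, n)) (B : T -> 'M[R]_(n, p)) :
  measurable_mx A -> measurable_mx B -> measurable_mx (fun x => A x *m B x).
Proof.
move=> mA mB i j; rewrite (_ : (fun _ => _) = fun x => \sum_k A x i k * B x k j).
  by apply: measurable_sum => k; exact: measurable_funM.
by apply/funext => x; rewrite mxE.
Qed.

Lemma measurable_trmx m n (A : T -> 'M[R]_(m, n)) :
  measurable_mx A -> measurable_mx (fun x => (A x)^T).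
Proof.
move=> mA i j; rewrite (_ : (fun _ => _) = fun x => A x j i); first exact: mA.
by apply/funext => x; rewrite mxE.
Qed.

Lemma measurable_det n (A : T -> 'M[R]_n) :
  measurable_mx A -> measurable_fun setT (fun x => \det (A x)).
Proof.
move=> mA; apply: measurable_sum => s; apply: measurable_funM => //.
by apply: measurable_prod => i _; exact: mA.
Qed.

Lemma measurable_invmx n (A : T -> 'M[R]_n) :
  measurable_mx A -> measurable_mx (fun x => invmx (A x)).
Proof.
move=> mA i j; have mdet := measurable_det mA.
rewrite (_ : (fun _ => _) = fun x => if \det (A x) == 0 then A x i j else
    (\det (A x))^-1 * \adj (A x) i j); last first.
  apply/funext => x; rewrite /invmx unitmxE unitfE.
  by case: eqP => //= _; rewrite mxE.
apply: measurable_fun_ifT => //; first exact: measurable_fun_eqr.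
apply: measurable_funM; first exact: measurable_funVr.
rewrite (_ : (fun _ => _) = fun x => cofactor (A x) j i); last first.
  by apply/funext => x; rewrite mxE.
apply: measurable_funM => //; apply: measurable_det => k l.
rewrite (_ : (fun _ => _) = fun x => A x (lift j k) (lift i l)) //.
by apply/funext => x; rewrite !mxE.
Qed.

End measurable_matrix.

(** * Moments of the inverse Gram matrix of a Gaussian matrix *)

Section gaussian_matrix.
Context {R : realType}.

(** Matrices are stored row by row, so that the tuple of a matrix with [n.+1]
    rows is the concatenation of its first row and of the tuple of the others;
    the sizes [n.+1 * m] and [m + n * m] are convertible. *)
Definition rows_of_tuple n m (t : (n * m).-tuple R) : 'M[R]_(n, m) :=
  \matrix_(k, i) nth 0 t (k * m + i).

Lemma measurable_rows n m : measurable_mx (@rows_of_tuple n m).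
Proof.
move=> k i; have ki : (k * m + i < n * m)%N.
  by rewrite (leq_trans (n := k.+1 * m))// ?leq_mul2r ?ltn_ord ?orbT// mulSn addnC ltn_add2r.
rewrite (_ : (fun _ => _) = fun t : (n * m).-tuple R => tnth t (Ordinal ki)).
  exact: measurable_tnth.
by apply/funext => t; rewrite mxE (tnth_nth 0).
Qed.

Lemma rows_tcat n m (x : m.-tuple R) (y : (n * m).-tuple R) :
  rows_of_tuple (tcat (x, y) : (n.+1 * m).-tuple R) =
  col_mx (row_of_tuple x) (rows_of_tuple y) :> 'M[R]_(1 + n, m).
Proof.
apply/matrixP => k i; rewrite !mxE; case: (fintype.splitP k) => j kj.
  rewrite !mxE (tnth_nth 0)/= kj ord1 mul0n add0n nth_cat size_tuple.
  by rewrite ltn_ord.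
rewrite !mxE/= kj nth_cat size_tuple mulnDl mul1n -addnA ltnNge leq_addr/=.
by rewrite addKn.
Qed.

Lemma measurable_gram_rows n m : measurable_mx (fun t => gram (@rows_of_tuple n m t)).
Proof.
apply: measurable_mulmx; first exact: measurable_rows.
by apply: measurable_trmx; exact: measurable_rows.
Qed.

(** The matrix of the form in [integral_stdgauss_quad] is here
    [1%:M + (2 * s) *: coproj G]. *)
Lemma integral_expR_coproj n m (G : 'M[R]_(n, m)) (s : R) :
  (n <= m)%N -> gram G \in unitmx -> 0 <= s ->
  (\int[stdgauss m]_x (expR (- (s * quad (coproj G) (row_of_tuple x))))%:E =
   ((Num.sqrt ((1 + 2 * s) ^+ (m - n)))^-1)%:E)%E.
Proof.
move=> nm uG s0; have s20 : 0 <= 2 * s by rewrite mulr_ge0.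
rewrite -(det_1Dcoproj nm uG s20).
have [_ <-] := integral_stdgauss_quad (posdef_1Dcoproj uG s20).
apply: eq_integral => x _; congr (expR _)%:E.
have Z (c : R) (A : 'M[R]_1) : (c *: A) 0 0 = c * A 0 0 by rewrite mxE.
rewrite addrAC subrr add0r /quad -scalemxAr -scalemxAl Z.
by field.
Qed.

Lemma measurable_quad_coproj0 n m (G : 'M[R]_(n, m)) :
  measurable [set x | quad (coproj G) (row_of_tuple x) = 0].
Proof.
rewrite -[X in measurable X]setTI.
exact: (measurable_quad (coproj G) measurableT (measurable_set1 0)).
Qed.

(** Letting [s] tend to infinity in [integral_expR_coproj]: a Gaussian vector
    almost surely leaves a fixed proper subspace. *)
Lemma stdgauss_coproj0 n m (G : 'M[R]_(n, m)) :
  (n < m)%N -> gram G \in unitmx ->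
  stdgauss m [set x | quad (coproj G) (row_of_tuple x) = 0] = 0%E.
Proof.
move=> nm uG; have mA := measurable_quad_coproj0 G; set A := mkset _ in mA *.
have bound s : 0 <= s -> (stdgauss m A <= ((Num.sqrt (1 + 2 * s))^-1)%:E)%E.
  move=> s0; have s1 : 1 <= 1 + 2 * s by rewrite lerDl mulr_ge0.
  have sp : 0 < 1 + 2 * s by rewrite (lt_le_trans _ s1).
  apply: (@le_trans _ _ ((Num.sqrt ((1 + 2 * s) ^+ (m - n)))^-1)%:E).
    rewrite -(integral_expR_coproj (ltnW nm) uG s0).
    rewrite -[A]setIT -integral_indic//; apply: ge0_le_integral => //.
    - exact/measurable_EFinP/measurable_indic.
    - apply/measurable_EFinP; apply: measurableT_comp => //.
      apply: measurableT_comp => //; apply: measurable_funM => //.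
      exact: measurable_quad.
    - move=> x _; rewrite lee_fin indicE.
      have [/set_mem xA|_] := boolP (x \in A); last exact: expR_ge0.
      by rewrite (xA : quad _ _ = 0) mulr0 oppr0 expR0.
  rewrite lee_fin lef_pV2 ?posrE ?sqrtr_gt0 ?exprn_gt0// ler_wsqrtr//.
  by rewrite -[leLHS]expr1 ler_weXn2l ?subn_gt0.
have Afin : stdgauss m A \is a fin_num by exact: fin_num_measure.
apply/eqP; rewrite eq_le measure_ge0 andbT leNgt; apply/negP.
move: bound; rewrite -(fineK Afin); set r := fine _ => bound.
rewrite lte_fin => r0.
have r20 : 0 < r ^- 2 by rewrite invr_gt0 exprn_gt0.
have := bound (r ^- 2) (ltW r20); rewrite lee_fin leNgt => /negP; apply.
rewrite -[ltRHS]invrK ltf_pV2 ?posrE ?invr_gt0// ?sqrtr_gt0; last first.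
  by rewrite ltr_pwDl// mulr_ge0// ltW.
rewrite -[ltLHS]ger0_norm ?invr_ge0 ?ltW// -sqrtr_sqr ltr_sqrt ?exprVn; last first.
  by rewrite ltr_pwDl// mulr_ge0// ltW.
by lra.
Qed.

(** Tonelli's theorem: the measure of [A] is the mean of the measures of its
    sections. *)
Lemma stdgauss_cat_null m k (A : set ((m + k).-tuple R)) : measurable A ->
  {ae stdgauss k, forall y, stdgauss m [set x | A (tcat (x, y))] = 0%E} ->
  stdgauss (m + k) A = 0%E.
Proof.
move=> mA A0; pose h (z : (m + k).-tuple R) := (\1_A z)%:E : \bar R.
have mh : measurable_fun setT h.
  by apply/measurable_EFinP; exact: measurable_indic.
have h0 z : (0 <= h z)%E by rewrite lee_fin.
have mhc : measurable_fun setT (h \o @tcat R m k).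
  exact: (measurableT_comp mh (@measurable_tcat R m k)).
rewrite -[A]setIT -integral_indic// -/h integral_stdgauss_cat//.
transitivity (\int[stdgauss k]_y (@cst _ (\bar R) 0%E y))%E; last exact: integral0.
apply: ge0_ae_eq_integral => //.
- apply: (measurable_fun_fubini_tonelli_G (m1 := stdgauss m) _ mhc).
  by move=> ?; exact: h0.
- by move=> y _; apply: integral_ge0 => x _; exact: h0.
apply: filterS A0 => y Ay _; rewrite -[RHS]Ay.
transitivity (\int[stdgauss m]_x (\1_[set x | A (tcat (x, y))] x)%:E)%E => //.
rewrite integral_indic ?setIT//.
rewrite -[X in measurable X]setTI.
exact: (measurableT_comp (@measurable_tcat R m k) (pair2_measurable y)).
Qed.

Lemma measurable_dsub_rows n m : measurable_mx (fun t : (n.+1 * m).-tuple R =>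
  gram (dsubmx (rows_of_tuple t : 'M[R]_(1 + n, m)))).
Proof.
have mD : measurable_mx (fun t : (n.+1 * m).-tuple R =>
    dsubmx (rows_of_tuple t : 'M[R]_(1 + n, m))).
  move=> i j; rewrite (_ : (fun _ => _) = fun t : (n.+1 * m).-tuple R =>
      (rows_of_tuple t : 'M[R]_(1 + n, m)) (rshift 1 i) j).
    exact: (@measurable_rows n.+1 m (rshift 1 i) j).
  by apply/funext => t; rewrite mxE.
by apply: measurable_mulmx => //; exact: measurable_trmx.
Qed.

(** By induction on the number of rows: given the previous rows, the new row
    almost surely avoids their span. *)
Lemma det_gram_neq0 n m : (n <= m)%N ->
  {ae stdgauss (n * m), forall y, \det (gram (@rows_of_tuple n m y)) != 0}.
Proof.
elim: n => [|n IH] nm.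
  by apply: aeW => y; rewrite det_mx00 oner_eq0.
pose A := [set t : (n.+1 * m).-tuple R | \det (gram (rows_of_tuple t)) = 0].
exists A; split; last by move=> t /= /negP/negPn/eqP.
- rewrite -[X in measurable X]setTI.
  exact: (measurable_det (@measurable_gram_rows n.+1 m) measurableT
    (measurable_set1 0)).
apply: (@stdgauss_cat_null m (n * m)).
  rewrite -[X in measurable X]setTI.
  exact: (measurable_det (@measurable_gram_rows n.+1 m) measurableT
    (measurable_set1 0)).
apply: filterS (IH (ltnW nm)) => y y0.
have uy : gram (rows_of_tuple y) \in unitmx by rewrite unitmxE unitfE.
rewrite -[RHS](stdgauss_coproj0 nm uy).
congr (stdgauss m _); apply/seteqP.
split=> x; rewrite /A/= rows_tcat det_gram_col_mx// => /eqP.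
  by rewrite mulf_eq0 (negPf y0) orbF => /eqP.
by move=> /eqP ->; rewrite mul0r.
Qed.

(** The squared distance from the first row to the span of the others, written
    with determinants so that it is a measurable function of the tuple even
    where the Gram matrix of the other rows is singular. *)
Definition schur_ratio n m (t : (n.+1 * m).-tuple R) : R :=
  \det (gram (rows_of_tuple t)) /
  \det (gram (dsubmx (rows_of_tuple t : 'M[R]_(1 + n, m)))).

Lemma measurable_schur_ratio n m :
  measurable_fun setT (@schur_ratio n m).
Proof.
apply: measurable_funM; first exact: measurable_det (@measurable_gram_rows n.+1 m).
apply: measurable_funVr; exact: measurable_det (@measurable_dsub_rows n m).
Qed.

Lemma schur_ratioE n m (t : (n.+1 * m).-tuple R) :
  \det (gram (dsubmx (rows_of_tuple t : 'M[R]_(1 + n, m)))) != 0 ->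
  schur_ratio t = quad (coproj (dsubmx (rows_of_tuple t : 'M[R]_(1 + n, m))))
    (usubmx (rows_of_tuple t : 'M[R]_(1 + n, m))).
Proof.
move=> d0; rewrite /schur_ratio.
rewrite -[X in gram X](@vsubmxK _ 1 n m (rows_of_tuple t)).
by rewrite det_gram_col_mx ?unitmxE ?unitfE ?col_mxKd// mulfK.
Qed.

(** Given the other rows, [schur_ratio] is the form [coproj] at the first row, so
    that [integral_expR_coproj] gives the same value for almost all of them. *)
Lemma integral_expR_schur_ratio n m (s : R) : (n < m)%N -> 0 <= s ->
  (\int[stdgauss (n.+1 * m)]_t (expR (- (s * schur_ratio t)))%:E =
   ((Num.sqrt ((1 + 2 * s) ^+ (m - n)))^-1)%:E)%E.
Proof.
move=> nm s0; set c := (Num.sqrt _)^-1.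
pose h (t : (n.+1 * m).-tuple R) := (expR (- (s * schur_ratio t)))%:E.
have mh : measurable_fun setT h.
  apply/measurable_EFinP; apply: measurableT_comp => //.
  apply: measurableT_comp => //; apply: measurable_funM => //.
  exact: measurable_schur_ratio.
have h0 t : (0 <= h t)%E by rewrite lee_fin expR_ge0.
have mhc : measurable_fun setT (h \o @tcat R m (n * m)).
  exact: (measurableT_comp mh (@measurable_tcat R m (n * m))).
rewrite -/h (@integral_stdgauss_cat R m (n * m))//.
transitivity (\int[stdgauss (n * m)]_y (cst c%:E y))%E; last first.
  by rewrite integral_cst//= [X in (_ * X)%E]probability_setT mule1.
apply: ge0_ae_eq_integral => //.
- apply: (measurable_fun_fubini_tonelli_G (m1 := stdgauss m) _ mhc).
  by move=> ?; exact: h0.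
- by move=> y _; apply: integral_ge0 => x _; exact: h0.
- by move=> y _; rewrite lee_fin invr_ge0.
apply: filterS (det_gram_neq0 (ltnW nm)) => y y0 _.
have uy : gram (rows_of_tuple y) \in unitmx by rewrite unitmxE unitfE.
rewrite /= -(integral_expR_coproj (ltnW nm) uy s0).
apply: eq_integral => x _; rewrite /h schur_ratioE rows_tcat ?col_mxKd//.
by rewrite col_mxKu.
Qed.

(** A negative power is dominated by a series of exponentials, which turns the
    bound on the Laplace transform into a bound on moments. *)
Lemma powR_inv_le_nneseries (D q : R) : 0 < D -> 0 <= q ->
  (((D^-1) `^ q)%:E <=
   1 + \sum_(l <oo) ((2 `^ q) ^+ l.+1 * expR (1 - 2 ^+ l * D))%:E)%E.
Proof.
move=> D0 q0.
pose u l : \bar R := ((2 `^ q) ^+ l.+1 * expR (1 - 2 ^+ l * D))%:E.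
rewrite -/(u _).
have u0 l : (0 <= u l)%E by rewrite lee_fin mulr_ge0 ?expR_ge0// exprn_ge0// powR_ge0.
have Di0 : 0 < D^-1 by rewrite invr_gt0.
have [D1|D1] := leP D^-1 1.
  apply: (@le_trans _ _ 1%E).
    rewrite lee_fin (_ : 1 = 1 `^ q); last by rewrite powR1.
    apply: ge0_ler_powR => //.
    - by rewrite nnegrE ltW.
    - by rewrite nnegrE.
  by rewrite leeDl// nneseries_ge0.
(* The dyadic index of [D^-1] makes the exponential at least one. *)
pose N := Num.truncn D^-1; pose l := trunc_log 2 N.
have /andP[ND DN] := truncn_itv (ltW Di0).
have N0 : (0 < N)%N by rewrite truncn_gt_nat ltW.
have l1 : 2 ^+ l <= D^-1.
  by rewrite (le_trans _ ND)// -natrX ler_nat trunc_logP.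
have l2 : D^-1 <= 2 ^+ l.+1.
  by rewrite (le_trans (ltW DN))// -natrX ler_nat trunc_log_ltn.
apply: (@le_trans _ _ (u l)).
  rewrite lee_fin; apply: (@le_trans _ _ ((2 `^ q) ^+ l.+1)).
    rewrite -powR_mulrn ?powR_ge0// -powRrM mulrC powRrM powR_mulrn//.
    by apply: ge0_ler_powR => //; rewrite nnegrE ?exprn_ge0// ltW.
  rewrite ler_peMr ?exprn_ge0 ?powR_ge0// -[leLHS]expR0 ler_expR subr_ge0.
  by rewrite -ler_pdivlMr// div1r.
apply: (@le_trans _ _ (\sum_(0 <= k < l.+1) u k)%E).
  by rewrite big_nat_recr//= leeDr// sume_ge0.
by rewrite (le_trans (nneseries_lim_ge _ _))// leeDr.
Qed.

(** Sum of the dyadic series bounding the moment of order [q], when the Laplace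
    transform at [s] is at most [(2 * s) `^ (- k)]. *)
Definition moment_bound (q k : R) : R :=
  1 + expR 1 * 2 `^ (q - k) / (1 - 2 `^ (q - k)).

Lemma sqrt_expn_inv_le (x k : R) (j : nat) : 1 <= x -> k <= j%:R / 2 ->
  (Num.sqrt ((1 + x) ^+ j))^-1 <= x `^ (- k).
Proof.
move=> x1 kj; have x0 : 0 < x by rewrite (lt_le_trans _ x1).
have xj : x `^ (j%:R / 2) = Num.sqrt (x ^+ j).
  by rewrite powRrM powR_mulrn ?ltW// powR12_sqrt// exprn_ge0// ltW.
rewrite powRN lef_pV2 ?posrE ?powR_gt0 ?sqrtr_gt0 ?exprn_gt0 ?addr_gt0//.
rewrite (le_trans (ler_powR x1 kj))// xj ler_wsqrtr// lerXn2r ?nnegrE ?ltW//.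
  by rewrite addr_gt0.
by rewrite ltrDr.
Qed.

Lemma schur_ratio_ge0 n m (t : (n.+1 * m).-tuple R) : 0 <= schur_ratio t.
Proof.
have [d0|d0] := eqVneq (\det (gram (dsubmx (rows_of_tuple t : 'M[R]_(1 + n, m))))) 0.
  by rewrite /schur_ratio d0 invr0 mulr0.
by rewrite schur_ratioE// quad_coproj_ge0// unitmxE unitfE.
Qed.

Lemma nneseries_geometric_le (a z : R) : 0 <= a -> 0 < z < 1 ->
  (\sum_(l <oo) (a * z ^+ l)%:E <= (a / (1 - z))%:E)%E.
Proof.
move=> a0 /andP[z0 z1].
apply: lime_le; first by apply: is_cvg_nneseries => l _ _; rewrite lee_fin mulr_ge0// exprn_ge0// ltW.
apply: nearW => l; rewrite sumEFin lee_fin.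
by rewrite geometric_le_lim// ger0_norm ?ltW.
Qed.

(** The series of [powR_inv_le_nneseries] is integrated term by term with
    [integral_expR_schur_ratio]; the result is a geometric series of ratio
    [2 `^ (q - k)]. *)
Lemma integral_schur_ratio_powR n m (q k : R) : (n < m)%N ->
  0 <= q -> q < k -> k <= (m - n)%:R / 2 ->
  (\int[stdgauss (n.+1 * m)]_t (((schur_ratio t)^-1) `^ q)%:E <=
   (moment_bound q k)%:E)%E.
Proof.
move=> nm q0 qk km.
have mD := @measurable_schur_ratio n m.
pose u (l : nat) (t : (n.+1 * m).-tuple R) : \bar R :=
  ((2 `^ q) ^+ l.+1 * expR (1 - 2 ^+ l * schur_ratio t))%:E.
have mu l : measurable_fun setT (u l).
  apply/measurable_EFinP; apply: measurable_funM => //.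
  apply: measurableT_comp => //; apply: measurable_funB => //.
  exact: measurable_funM.
have u0 l t : (0 <= u l t)%E.
  by rewrite lee_fin mulr_ge0 ?expR_ge0// exprn_ge0// powR_ge0.
apply: (@le_trans _ _ (\int[stdgauss (n.+1 * m)]_t (1 + \sum_(l <oo) u l t))%E).
  apply: ge0_le_integral => //.
  - by move=> t _; rewrite lee_fin powR_ge0.
  - apply/measurable_EFinP.
    exact: (measurableT_comp (@measurable_powR R q) (measurable_funVr mD)).
  - by apply: emeasurable_funD => //; apply: ge0_emeasurable_sum.
  - move=> t _; have := schur_ratio_ge0 t.
    rewrite le_eqVlt => /predU1P[<-|D0]; last exact: powR_inv_le_nneseries.
    rewrite invr0 (@le_trans _ _ 1%E) ?leeDl ?nneseries_ge0//.
    by rewrite lee_fin /powR eqxx; case: (q == 0).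
rewrite ge0_integralD//; last 2 first.
- by move=> t _; exact: nneseries_ge0.
- exact: ge0_emeasurable_sum.
rewrite integral_cst//= [X in (1 * X)%E]probability_setT mul1e.
rewrite /moment_bound EFinD leeD2l// integral_nneseries//.
have z01 : 0 < (2 : R) `^ (q - k) < 1.
  by rewrite powR_gt0//= /powR pnatr_eq0/= expR_lt1 pmulr_llt0 ?subr_lt0// ln_gt0// ltr1n.
have a0 : 0 <= expR 1 * 2 `^ (q - k) by rewrite mulr_ge0 ?expR_ge0 ?powR_ge0.
apply: le_trans (nneseries_geometric_le a0 z01).
apply: lee_nneseries => [l _ _|l _]; first exact: integral_ge0.
have E t : u l t = (((2 `^ q) ^+ l.+1 * expR 1)%:E *
    (expR (- (2 ^+ l * schur_ratio t)))%:E)%E.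
  by rewrite -EFinM -mulrA -expRD.
under eq_integral do rewrite E.
rewrite ge0_integralZl//; last first.
  apply/measurable_EFinP; apply: measurableT_comp => //.
  by apply: measurableT_comp => //; exact: measurable_funM.
rewrite integral_expR_schur_ratio ?exprn_ge0// -EFinM lee_fin -exprS.
apply: (@le_trans _ _ ((2 `^ q) ^+ l.+1 * expR 1 * (2 ^+ l.+1) `^ (- k))).
  rewrite ler_wpM2l ?mulr_ge0 ?expR_ge0// ?exprn_ge0 ?powR_ge0//.
  by apply: sqrt_expn_inv_le => //; rewrite exprn_ege1// ler1n.
have -> : (2 ^+ l.+1) `^ (- k) = (2 `^ (- k)) ^+ l.+1 :> R.
  rewrite -(powR_mulrn l.+1 (ler0n R 2)) -powRrM mulrC powRrM.
  by rewrite powR_mulrn// powR_ge0.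
rewrite mulrAC -exprMn -powRD ?(@pnatr_eq0 R) ?implybT//.
by rewrite mulrC -mulrA -exprS.
Qed.

End gaussian_matrix.

(** * Law of the design matrix *)

Section gaussian_design.
Context {R : realType} {d : measure_display} {T : measurableType d}.
Context {P : probability T R} {n m : nat}.
Variable X : 'I_m -> {RV P >-> n.-tuple R}.
Hypothesis m0 : (0 < m)%N.
Hypothesis iidX : iid_gaussian X.

Definition flat_ord (k : 'I_n) (i : 'I_m) : 'I_(n * m).
Proof.
exists (k * m + i)%N.
by rewrite (leq_trans (n := k.+1 * m))// ?leq_mul2r ?ltn_ord ?orbT// mulSn addnC ltn_add2r.
Defined.

Definition col_ord (r : 'I_(n * m)) : 'I_n.
Proof. by exists (r %/ m)%N; rewrite ltn_divLR. Defined.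

Definition row_ord (r : 'I_(n * m)) : 'I_m.
Proof. by exists (r %% m)%N; rewrite ltn_pmod. Defined.

Lemma big_flat_ord (F : 'I_(n * m) -> \bar R) :
  (\prod_(r < n * m) F r = \prod_(i < m) \prod_(k < n) F (flat_ord k i))%E.
Proof.
rewrite exchange_big pair_big/=.
rewrite (reindex (fun p : 'I_n * 'I_m => flat_ord p.1 p.2))//=.
exists (fun r => (col_ord r, row_ord r)) => [[k i] _|r _].
  congr pair; apply: val_inj => /=; first by rewrite divnMDl// divn_small// addn0.
  by rewrite modnMDl modn_small.
by apply: val_inj => /=; rewrite -divn_eq.
Qed.

(** The entries of the transposed design matrix, stored as in [rows_of_tuple],
    after the permutation [s] of the columns of the design matrix: any column
    can be brought to the first position. *)
Definition flat_tuple (s : {perm 'I_n}) (w : T) : (n * m).-tuple R :=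
  [tuple tnth (X (row_ord r) w) (s (col_ord r)) | r < n * m].

Lemma measurable_flat_tuple s : measurable_fun setT (flat_tuple s).
Proof.
apply/measurable_fun_tnthP => r.
rewrite (_ : _ \o _ = fun w => tnth (X (row_ord r) w) (s (col_ord r))).
  exact: (measurableT_comp (measurable_tnth _) (@measurable_funPT _ _ _ _ _)).
by apply/funext => w /=; rewrite tnth_mktuple.
Qed.

HB.instance Definition _ s :=
  isMeasurableFun.Build _ _ _ _ (flat_tuple s) (measurable_flat_tuple s).

(** Independence of the sample points and independence of the coordinates of
    each of them make all entries independent standard normal variables,
    whatever the order in which they are listed. *)
Lemma distribution_flat_tuple s A : measurable A ->
  distribution P (flat_tuple s : {RV P >-> (n * m).-tuple R}) A = stdgauss (n * m) A.
Proof.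
move: A; apply: distribution_stdgauss => B mB.
pose C i := [set x : n.-tuple R |
  forall k, B (flat_ord ((s^-1)%g k) i) (tnth x k)].
have mC i : measurable (C i).
  exact: (@measurable_rect R n (fun k => B (flat_ord ((s^-1)%g k) i)) (fun k => mB _)).
transitivity (P (\bigcap_(i in [set` [set: 'I_m]%SET]) (X i @^-1` C i))).
  congr (P _); apply/seteqP; split => w /= Bw.
    move=> i _ k; have := Bw (flat_ord ((s^-1)%g k) i).
    rewrite tnth_mktuple.
    have -> : col_ord (flat_ord ((s^-1)%g k) i) = (s^-1)%g k.
      by apply: val_inj; rewrite /= divnMDl// divn_small// addn0.
    have -> : row_ord (flat_ord ((s^-1)%g k) i) = i.
      by apply: val_inj; rewrite /= modnMDl modn_small.
    by rewrite permKV.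
  move=> r; rewrite tnth_mktuple.
  have rT : [set` [set: 'I_m]%SET] (row_ord r) by rewrite /= finset.in_setT.
  have := Bw (row_ord r) rT (s (col_ord r)); rewrite permK.
  by have -> : flat_ord (col_ord r) (row_ord r) = r by
    apply: val_inj; rewrite /= -divn_eq.
have [indX lawX] := iidX.
rewrite indX// big_flat_ord.
apply: eq_big => [i|i _]; first by rewrite finset.in_setT.
transitivity (distribution P (X i) (C i)) => //.
rewrite lawX// gaussian_measure_stdgauss//.
rewrite [LHS](@stdgauss_rect R n (fun k => B (flat_ord ((s^-1)%g k) i)))//.
by rewrite (reindex_perm s)/=; apply: eq_bigr => k _; rewrite permK.
Qed.

Definition gram_inv (w : T) : 'M[R]_n :=
  invmx ((Gamma_mx X w)^T *m Gamma_mx X w).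

Lemma gram_flat_tuple (s : {perm 'I_n}) w :
  gram (rows_of_tuple (flat_tuple s w)) =
  perm_mx s *m ((Gamma_mx X w)^T *m Gamma_mx X w) *m (perm_mx s)^T.
Proof.
have -> : rows_of_tuple (flat_tuple s w) = perm_mx s *m (Gamma_mx X w)^T.
  apply/matrixP => k i; rewrite -row_permE !mxE.
  rewrite -[nth _ _ _](@tnth_nth _ _ 0 (flat_tuple s w) (flat_ord k i)).
  rewrite tnth_mktuple.
  have -> : col_ord (flat_ord k i) = k.
    by apply: val_inj; rewrite /= divnMDl// divn_small// addn0.
  have -> // : row_ord (flat_ord k i) = i.
  by apply: val_inj; rewrite /= modnMDl modn_small.
by rewrite /gram trmx_mul trmxK !mulmxA.
Qed.

Lemma det_gram_flat_tuple (s : {perm 'I_n}) w :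
  \det (gram (rows_of_tuple (flat_tuple s w))) =
  \det ((Gamma_mx X w)^T *m Gamma_mx X w).
Proof.
rewrite gram_flat_tuple !(det_mulmx (_ *m _)) det_tr det_mulmx det_perm.
by rewrite mulrAC -signr_addb addbb mul1r.
Qed.

Lemma invmx_gram_flat_tuple (s : {perm 'I_n}) w i j :
  (Gamma_mx X w)^T *m Gamma_mx X w \in unitmx ->
  invmx (gram (rows_of_tuple (flat_tuple s w))) i j = gram_inv w (s i) (s j).
Proof.
rewrite gram_flat_tuple /gram_inv; move: (_ *m Gamma_mx X w) => A uA.
have uB : perm_mx s *m A *m (perm_mx s)^T \in unitmx.
  by rewrite !unitmx_mul uA unitmx_tr unitmx_perm.
suff -> : invmx (perm_mx s *m A *m (perm_mx s)^T) =
    perm_mx s *m invmx A *m (perm_mx s)^T.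
  by rewrite tr_perm_mx -col_permE -row_permE !mxE.
apply: (can_inj (mulKmx uB)); rewrite mulmxV//.
rewrite tr_perm_mx -!mulmxA [perm_mx s^-1 *m (perm_mx s *m _)]mulmxA.
rewrite -perm_mxM mulVg perm_mx1 mul1mx [A *m (invmx A *m _)]mulmxA mulmxV//.
by rewrite mul1mx -perm_mxM mulgV perm_mx1.
Qed.

Lemma measurable_Gamma : measurable_mx (Gamma_mx X).
Proof.
move=> i j; rewrite (_ : (fun _ => _) = fun w => tnth (X i w) j).
  exact: (measurableT_comp (measurable_tnth _) (@measurable_funPT _ _ _ _ _)).
by apply/funext => w; rewrite mxE.
Qed.

Lemma measurable_gram_inv : measurable_mx gram_inv.
Proof.
apply: measurable_invmx; apply: measurable_mulmx; last exact: measurable_Gamma.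
by apply: measurable_trmx; exact: measurable_Gamma.
Qed.

Lemma ae_unitmx_design : (n <= m)%N ->
  {ae P, forall w, (Gamma_mx X w)^T *m Gamma_mx X w \in unitmx}.
Proof.
move=> nm.
pose A := [set t : (n * m).-tuple R | \det (gram (rows_of_tuple t)) = 0].
have mA : measurable A.
  rewrite -[X in measurable X]setTI.
  exact: (measurable_det (@measurable_gram_rows R n m) measurableT (measurable_set1 0)).
exists (flat_tuple 1%g @^-1` A); split.
- rewrite -[X in measurable X]setTI.
  exact: (measurable_flat_tuple 1%g measurableT mA).
- transitivity (stdgauss (n * m) A); first by rewrite -(distribution_flat_tuple 1%g).
  apply/negligibleP => //; apply: negligibleS (det_gram_neq0 nm) => t /= At.
  by apply/negP; rewrite negbK At.
- move=> w /negP; rewrite unitmxE unitfE negbK => /eqP wA.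
  by rewrite /A/= det_gram_flat_tuple.
Qed.

End gaussian_design.

Section inverse_gram_moment.
Context {R : realType} {d : measure_display} {T : measurableType d}.
Context {P : probability T R} {n m : nat}.
Variable X : 'I_m -> {RV P >-> n.+1.-tuple R}.
Hypothesis iidX : iid_gaussian X.

(** Swapping the columns [0] and [j] reduces to the corner entry, which is the
    inverse of [schur_ratio]. *)
Lemma integral_gram_inv_powR (j : 'I_n.+1) (q k : R) : (n < m)%N ->
  0 <= q -> q < k -> k <= (m - n)%:R / 2 ->
  (\int[P]_w ((gram_inv X w j j) `^ q)%:E <= (moment_bound q k)%:E)%E.
Proof.
move=> nm q0 qk km; have m0 : (0 < m)%N by rewrite (leq_trans _ nm).
pose Y := flat_tuple X m0 (tperm 0 j).
pose h (t : (n.+1 * m).-tuple R) := (((schur_ratio t)^-1) `^ q)%:E.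
have mh : measurable_fun setT h.
  apply/measurable_EFinP; apply: (measurableT_comp (@measurable_powR R q)).
  by apply: measurable_funVr; exact: measurable_schur_ratio.
have h0 t : (0 <= h t)%E by rewrite lee_fin powR_ge0.
have mY : measurable_fun setT Y by exact: measurable_flat_tuple.
rewrite (_ : (\int[P]_w _)%E = (\int[P]_w h (Y w))%E); last first.
  apply: ge0_ae_eq_integral => //.
  - apply/measurable_EFinP; apply: (measurableT_comp (@measurable_powR R q)).
    exact: measurable_gram_inv.
  - exact: (measurableT_comp mh mY).
  - by move=> w _; rewrite lee_fin powR_ge0.
  apply: filterS (ae_unitmx_design m0 iidX nm) => w uw _.
  have d0 : gram (rows_of_tuple (Y w)) \in unitmx.
    by rewrite unitmxE det_gram_flat_tuple -unitmxE.
  have := invmx_gram_flat_tuple m0 (tperm 0 j) 0 0 uw.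
  rewrite tpermL -/(Y w) => <-; rewrite /h/=.
  rewrite -[X in gram X](@vsubmxK _ 1 n m (rows_of_tuple (Y w))).
  by rewrite invmx_gram00 ?vsubmxK// /schur_ratio invf_div.
have := @ge0_integral_pushforward _ _ _ _ R Y mY P setT h measurableT mh.
rewrite preimage_setT => <-//.
rewrite (eq_measure_integral (stdgauss (n.+1 * m))); last first.
  by move=> A mA _; exact: (distribution_flat_tuple m0 iidX (tperm 0 j)).
exact: integral_schur_ratio_powR.
Qed.

End inverse_gram_moment.

(** * Regression error *)

Section regression_error.
Context {R : realType} {d : measure_display} {T : measurableType d}.
Context {P : probability T R} {n m : nat}.
Variables (X : 'I_m -> {RV P >-> n.-tuple R}) (f : n.-tuple R -> R).
Hypothesis mf : measurable_fun setT f.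

Lemma measurable_beta : measurable_mx (beta X f).
Proof.
apply: measurable_mulmx.
  apply: measurable_mulmx; first exact: measurable_gram_inv.
  by apply: measurable_trmx; exact: measurable_Gamma.
move=> i j; rewrite (_ : (fun _ => _) = fun w => f (X i w)).
  exact: (measurableT_comp mf (@measurable_funPT _ _ _ _ _)).
by apply/funext => w; rewrite mxE.
Qed.

Lemma measurable_residue (a : 'cV[R]_n) : measurable_fun setT (residue f a).
Proof.
apply: measurable_funB => //; apply: measurable_sum => j.
by apply: measurable_funM => //; exact: measurable_tnth.
Qed.

(** Cauchy-Schwarz: with [a], [b] and [c] the sums of the [u i ^+ 2], of the
    [v i ^+ 2] and of the [u i * v i], the sum of the squares of the
    [a * v i - c * u i] is [a * (a * b - c ^+ 2)]. *)
Lemma sum_mul_sqr_le k (u v : 'I_k -> R) :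
  (\sum_i u i * v i) ^+ 2 <= (\sum_i u i ^+ 2) * (\sum_i v i ^+ 2).
Proof.
set a := \sum_i u i ^+ 2; set b := \sum_i v i ^+ 2; set c := \sum_i u i * v i.
have a0 : 0 <= a by rewrite sumr_ge0// => i _; rewrite sqr_ge0.
have : 0 <= \sum_i (a * v i - c * u i) ^+ 2.
  by rewrite sumr_ge0// => i _; rewrite sqr_ge0.
have -> : \sum_i (a * v i - c * u i) ^+ 2 = a * (a * b - c ^+ 2).
  transitivity (\sum_i (a ^+ 2 * v i ^+ 2 - 2 * a * c * (u i * v i) + c ^+ 2 * u i ^+ 2)).
    by apply: eq_bigr => i _; ring.
  rewrite big_split sumrB/= -!mulr_sumr -/a -/b -/c; ring.
move: a0; rewrite le_eqVlt => /predU1P[a0 _|a0]; last first.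
  by rewrite pmulr_rge0// subr_ge0.
rewrite -a0 mul0r (_ : c = 0) ?expr0n// /c big1// => i _.
have /eqP := esym a0; rewrite psumr_eq0 => [/allP ua|k0 _]; last exact: sqr_ge0.
have := ua i (mem_index_enum _).
by rewrite sqrf_eq0 => /eqP ->; rewrite mul0r.
Qed.

(** With [u] the [j]-th row of the pseudo-inverse, the error of the coordinate
    [j] is the product of [u] and the residues, and the squared norm of [u] is
    the diagonal entry of the inverse Gram matrix. *)
Lemma sqr_beta_sub_le (a : 'cV[R]_n) (w : T) (j : 'I_n) :
  (Gamma_mx X w)^T *m Gamma_mx X w \in unitmx ->
  0 <= gram_inv X w j j /\
  (beta X f w j 0 - a j 0) ^+ 2 <=
    gram_inv X w j j * \sum_(i < m) residue f a (X i w) ^+ 2.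
Proof.
move=> uA; set G := Gamma_mx X w in uA *.
pose U := invmx (G^T *m G) *m G^T.
pose r : 'cV[R]_m := \col_i residue f a (X i w).
have E : beta X f w - a = U *m r.
  have -> : r = F_vec X f w - G *m a.
    apply/colP => i; rewrite !mxE /residue; congr (_ - _).
    by apply: eq_bigr => k _; rewrite !mxE mulrC.
  have Ua : U *m (G *m a) = a.
    by rewrite mulmxA -(mulmxA (invmx _)) mulVmx// mul1mx.
  by rewrite mulmxBr Ua.
have gE : gram_inv X w j j = \sum_i U j i ^+ 2.
  have -> : gram_inv X w = U *m U^T.
    rewrite /U trmx_mul trmxK trmx_inv trmx_mul trmxK mulmxA.
    by rewrite -(mulmxA (invmx _)) mulVmx// mul1mx.
  by rewrite mxE; apply: eq_bigr => i _; rewrite expr2 [U^T _ _]mxE.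
split; first by rewrite gE sumr_ge0// => i _; rewrite sqr_ge0.
have -> : beta X f w j 0 - a j 0 = \sum_i U j i * residue f a (X i w).
  transitivity ((beta X f w - a) j 0); first by rewrite [RHS]mxE [(- a) _ _]mxE.
  by rewrite E mxE; apply: eq_bigr => i _; rewrite [r _ _]mxE.
by rewrite gE; exact: sum_mul_sqr_le.
Qed.

(** [covariance] centres at the finite part of the expectation, which is the
    coordinate of [beta_bar]. *)
Lemma TrCovE : TrCov X f = (\sum_(j < n) \int[P]_w
   ((beta X f w j 0 - beta_bar X f j 0) ^+ 2)%:E)%E.
Proof.
rewrite /TrCov /mxtrace; apply: eq_bigr => j _.
rewrite mxE unlock unlock; apply: eq_integral => w _.
by rewrite expr2 [beta_bar X f j 0]mxE unlock.
Qed.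

Lemma ae_gaussian_sample (Q : n.-tuple R -> Prop) (i : 'I_m) :
  iid_gaussian X -> {ae gaussian_measure n, forall x, Q x} ->
  {ae P, forall w, Q (X i w)}.
Proof.
move=> [_ lawX] [A [mA A0 QA]]; exists (X i @^-1` A); split.
- by rewrite -[Y in measurable Y]setTI; exact: (@measurable_funPT _ _ _ _ (X i)).
- by rewrite -[RHS]A0 -(lawX i).
- by move=> w /= Qw; exact: QA.
Qed.

End regression_error.

Section error_moments.
Context {R : realType} {d : measure_display} {T : measurableType d}.
Context {P : probability T R} {n m : nat}.
Variables (X : 'I_m -> {RV P >-> n.+1.-tuple R}) (f : n.+1.-tuple R -> R).
Hypothesis mf : measurable_fun setT f.
Hypothesis iidX : iid_gaussian X.

Lemma measurable_gram_inv_powR j q :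
  measurable_fun setT (fun w => (gram_inv X w j j) `^ q).
Proof.
apply: (measurableT_comp (@measurable_powR R q)); exact: measurable_gram_inv.
Qed.

Lemma measurable_beta_sub (a : 'cV[R]_n.+1) j :
  measurable_fun setT (fun w => beta X f w j 0 - a j 0).
Proof. by apply: measurable_funB => //; exact: measurable_beta. Qed.

Lemma ae_sqr_beta_sub_le (a : 'cV[R]_n.+1) j : (n < m)%N ->
  {ae P, forall w, 0 <= gram_inv X w j j /\
    (beta X f w j 0 - a j 0) ^+ 2 <=
      gram_inv X w j j * \sum_(i < m) residue f a (X i w) ^+ 2}.
Proof.
move=> nm; have m0 : (0 < m)%N by rewrite (leq_trans _ nm).
apply: filterS (ae_unitmx_design m0 iidX nm) => w.
exact: sqr_beta_sub_le.
Qed.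

Section bounded_residue.
Variables (a : 'cV[R]_n.+1) (K : R).
Hypothesis nm : (n.+3 <= m)%N.
Hypothesis K0 : 0 <= K.
Hypothesis resK : {ae gaussian_measure n.+1, forall x, `|residue f a x| <= K}.

(* [3 / 2] is half of the least number of degrees of freedom, [3], attained at
   [m = n.+3]; this makes the constant independent of [n] and [m]. *)
Let C1 : R := moment_bound 1 (3 / 2).

Let gram_inv_le j : (\int[P]_w ((gram_inv X w j j) `^ 1)%:E <= C1%:E)%E.
Proof.
have nm' : (n < m)%N by rewrite (ltn_trans _ nm).
apply: integral_gram_inv_powR => //; first by lra.
by rewrite ler_pM2r ?invr_gt0// ler_nat leq_subRL ?addn3// ltnW.
Qed.

Lemma ae_sqr_beta_sub_bounded j :
  {ae P, forall w, (beta X f w j 0 - a j 0) ^+ 2 <=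
    m%:R * K ^+ 2 * (gram_inv X w j j) `^ 1}.
Proof.
have nm' : (n < m)%N by rewrite (ltn_trans _ nm).
have rK : {ae P, forall w, forall i : 'I_m, `|residue f a (X i w)| <= K}.
  apply: filter_forall => i.
  exact: (ae_gaussian_sample (Q := fun x => `|residue f a x| <= K) i iidX).
apply: filterS2 rK (ae_sqr_beta_sub_le a j nm') => w rKw [g0 le_g].
apply: (le_trans le_g); rewrite powRr1// mulrC ler_wpM2r//.
rewrite mulr_natl -[X in _ *+ X](card_ord m) -sumr_const.
apply: ler_sum => i _; rewrite -[leLHS]real_normK ?num_real//.
by rewrite lerXn2r ?nnegrE.
Qed.

Lemma integral_sqr_beta_sub_le j :
  (\int[P]_w ((beta X f w j 0 - a j 0) ^+ 2)%:E <= (m%:R * K ^+ 2 * C1)%:E)%E.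
Proof.
have mg := measurable_gram_inv_powR j 1.
apply: (@le_trans _ _ (\int[P]_w
    ((m%:R * K ^+ 2)%:E * ((gram_inv X w j j) `^ 1)%:E))%E).
  apply: ae_ge0_le_integral => //.
  - by move=> w _; rewrite lee_fin sqr_ge0.
  - by apply/measurable_EFinP/measurable_funX; exact: measurable_beta_sub.
  - by move=> w _; rewrite lee_fin mulr_ge0 ?powR_ge0// mulr_ge0 ?sqr_ge0.
  - by apply/measurable_EFinP; exact: measurable_funM.
  - by apply: filterS (ae_sqr_beta_sub_bounded j) => w + _; rewrite lee_fin.
rewrite ge0_integralZl//; last 3 first.
- exact/measurable_EFinP.
- by move=> w _; rewrite lee_fin powR_ge0.
- by rewrite lee_fin mulr_ge0 ?sqr_ge0.
by rewrite (EFinM (m%:R * K ^+ 2) C1) lee_wpmul2l ?gram_inv_le// lee_fin mulr_ge0 ?sqr_ge0.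
Qed.

(** The square root of [gram_inv X w j j] is at most half of its sum with [1]. *)
Lemma integral_norm_beta_sub_le j :
  (\int[P]_w `|beta X f w j 0 - a j 0|%:E <=
   (Num.sqrt m%:R * K * ((1 + C1) / 2))%:E)%E.
Proof.
have mg := measurable_gram_inv_powR j 1.
have c0 : 0 <= Num.sqrt m%:R * K / 2 by rewrite !mulr_ge0.
apply: (@le_trans _ _ (\int[P]_w ((Num.sqrt m%:R * K / 2)%:E *
    (1 + ((gram_inv X w j j) `^ 1)%:E)))%E).
  apply: ae_ge0_le_integral => //.
  - by apply/measurable_EFinP/measurableT_comp => //; exact: measurable_beta_sub.
  - by move=> w _; rewrite -EFinD lee_fin mulr_ge0// addr_ge0// powR_ge0.
  - apply/measurable_EFinP; apply: measurable_funM => //.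
    exact: measurable_funD.
  - apply: filterS (ae_sqr_beta_sub_bounded j) => w le_w _.
    rewrite -EFinD lee_fin; set g := _ `^ 1 in le_w *.
    have g0 : 0 <= g by rewrite powR_ge0.
    rewrite -sqrtr_sqr (le_trans (ler_wsqrtr le_w))//.
    rewrite sqrtrM ?mulr_ge0 ?sqr_ge0// (sqrtrM (K ^+ 2))//.
    rewrite sqrtr_sqr ger0_norm// -[leRHS]mulrA.
    rewrite ler_wpM2l ?mulr_ge0//.
    have := sqr_ge0 (Num.sqrt g - 1).
    rewrite sqrrB1 sqr_sqrtr//; lra.
rewrite ge0_integralZl//; last 2 first.
- by apply: emeasurable_funD => //; exact/measurable_EFinP.
- by move=> w _; rewrite -EFinD lee_fin addr_ge0// powR_ge0.
rewrite ge0_integralD//; last 2 first.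
- by move=> w _; rewrite lee_fin powR_ge0.
- exact/measurable_EFinP.
rewrite integral_cst//= [X in (1 * X)%E]probability_setT mul1e.
rewrite (_ : Num.sqrt m%:R * K * (_ / 2) = Num.sqrt m%:R * K / 2 * (1 + C1)); last by ring.
rewrite (EFinM (Num.sqrt m%:R * K / 2)) lee_wpmul2l ?lee_fin//.
by rewrite EFinD leeD2l ?gram_inv_le.
Qed.

End bounded_residue.

Lemma mulr_sqr_le_powR (w y r : R) : 2 < r -> 0 <= w ->
  w * y ^+ 2 <= w `^ (r / (r - 2)) + `|y| `^ r.
Proof.
move=> r2 w0; have r0 : 0 < r by rewrite (lt_trans _ r2).
have q0 : 0 < r / (r - 2) by rewrite divr_gt0// subr_gt0.
have p0 : 0 < r / 2 by rewrite divr_gt0.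
have conj : (r / (r - 2))^-1 + (r / 2)^-1 = 1.
  by field; rewrite !gt_eqF// subr_gt0.
apply: (le_trans (conjugate_powR w0 (sqr_ge0 y) q0 p0 conj)).
rewrite -[y ^+ 2]real_normK ?num_real// -powR_mulrn// -powRrM.
rewrite (_ : 2%:R * (r / 2) = r); last by field.
apply: lerD; rewrite ler_piMr ?powR_ge0// invf_le1//.
  by rewrite ler_pdivlMr ?subr_gt0// mul1r gerBl.
by rewrite ler_pdivlMr// mul1r ltW.
Qed.

Lemma integral_residue_powR_lty (a : 'cV[R]_n.+1) (r : R) (i : 'I_m) : 1 <= r ->
  residue f a \in Lfun (gaussian_measure n.+1) r%:E ->
  (\int[P]_w (`|residue f a (X i w)| `^ r)%:E < +oo)%E.
Proof.
move=> r1 resL; have mr := measurable_residue mf a.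
have /integrableP[mh] := Lfun_integrable r1 resL.
under eq_integral do rewrite gee0_abs ?lee_fin ?powR_ge0//.
move=> h_lty.
pose h x : \bar R := (`|residue f a x| `^ r)%:E.
have h0 x : (0 <= h x)%E by rewrite lee_fin powR_ge0.
have <- : (\int[distribution P (X i)]_x h x = \int[P]_w h (X i w))%E.
  exact: ge0_integral_distribution.
rewrite (eq_measure_integral (gaussian_measure n.+1))// => A mA _.
exact: (proj2 iidX).
Qed.

(** The squared error is at most a product of a diagonal entry of the inverse
    Gram matrix and of squared residues; by Young's inequality with the
    conjugate exponents [r / (r - 2)] and [r / 2], both moments are finite. *)
Lemma TrCov_lty (r : R) : 2 < r ->
  residue f (beta_bar X f) \in Lfun (gaussian_measure n.+1) r%:E ->
  n.+1%:R + (r + 2) / (r - 2) < m%:R :> R ->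
  (TrCov X f < +oo)%E.
Proof.
move=> r2 resL mr; rewrite TrCovE; apply: lte_sum_pinfty => j _.
set a := beta_bar X f in resL *.
have r0 : 0 < r by rewrite (lt_trans _ r2).
have r20 : 0 < r - 2 by rewrite subr_gt0.
have nm : (n < m)%N.
  rewrite -(ltr_nat R) (le_lt_trans _ mr)// -[leLHS]addr0 lerD ?ler_nat//.
  by rewrite divr_ge0 ?(ltW r20)// addr_ge0// ltW.
have mg := measurable_gram_inv_powR j (r / (r - 2)).
have mres (i : 'I_m) : measurable_fun setT (fun w => `|residue f a (X i w)| `^ r).
  apply: (measurableT_comp (@measurable_powR R r)).
  apply: measurableT_comp => //.
  exact: (measurableT_comp (measurable_residue mf a) (@measurable_funPT _ _ _ _ _)).
apply: (@le_lt_trans _ _ (\int[P]_w (\sum_(i < m)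
    (((gram_inv X w j j) `^ (r / (r - 2)))%:E + (`|residue f a (X i w)| `^ r)%:E)))%E).
  apply: ae_ge0_le_integral => //.
  - by move=> w _; rewrite lee_fin sqr_ge0.
  - by apply/measurable_EFinP/measurable_funX; exact: measurable_beta_sub.
  - by move=> w _; apply: sume_ge0 => i _; rewrite adde_ge0// lee_fin powR_ge0.
  - by apply: emeasurable_sum => i; apply: emeasurable_funD; exact/measurable_EFinP.
  - apply: filterS (ae_sqr_beta_sub_le a j nm) => w [g0 le_g] _.
    under eq_bigr do rewrite -EFinD.
    rewrite sumEFin lee_fin (le_trans le_g)// mulr_sumr ler_sum// => i _.
    exact: mulr_sqr_le_powR.
rewrite ge0_integral_sum//; last 2 first.
- by move=> i; apply: emeasurable_funD; exact/measurable_EFinP.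
- by move=> i w _; rewrite adde_ge0// lee_fin powR_ge0.
apply: lte_sum_pinfty => i _.
rewrite ge0_integralD//; try exact/measurable_EFinP; last first.
  by move=> w _; rewrite lee_fin powR_ge0.
apply: lte_add_pinfty; last first.
  by apply: integral_residue_powR_lty => //; rewrite ltW// (lt_trans _ r2)// ltr1n.
apply: (@le_lt_trans _ _ _ _ _ _ (ltry (moment_bound (r / (r - 2)) ((m - n)%:R / 2)))).
apply: integral_gram_inv_powR => //; first by rewrite divr_ge0 ?ltW.
rewrite natrB ?(ltnW nm)// ltr_pdivlMr//.
move: mr; rewrite -natr1 -addrA -ltrBrDl; apply: le_lt_trans.
by rewrite le_eqVlt; apply/orP; left; apply/eqP; field; rewrite gt_eqF.
Qed.

End error_moments.

(** * Confidence threshold and optimal sample size *)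

Section threshold.
Context {R : realType}.

(** On the half-line, [x ^+ 2 + (u - x) ^+ 2 <= u ^+ 2]. *)
Lemma gaussian_tail_le (x : R) : 0 < x ->
  ((Num.sqrt (2 * pi))^-1%:E *
    \int[lebesgue_measure]_(u in `[x, +oo[) (expR (- (u ^+ 2 / 2)))%:E <=
   (expR (- (x ^+ 2 / 2)))%:E)%E.
Proof.
move=> x0; set c := (Num.sqrt (2 * pi))^-1.
have c0 : 0 <= c by rewrite invr_ge0.
have mpdf := @measurable_normal_pdf R x 1.
have mI : measurable (`[x, +oo[ : set (measurableTypeR R)) by [].
have me : measurable_fun (`[x, +oo[ : set (measurableTypeR R))
    (fun u : R => (expR (- (u ^+ 2 / 2)))%:E).
  apply: measurable_funTS; apply/measurable_EFinP.
  apply: measurableT_comp => //; apply: measurableT_comp => //.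
  by apply: measurable_funM => //; exact: measurable_funX.
rewrite -ge0_integralZl//.
apply: (@le_trans _ _ (\int[lebesgue_measure]_(u in `[x, +oo[)
    ((expR (- (x ^+ 2 / 2)))%:E * (normal_pdf x 1 u)%:E))%E).
  apply: ge0_le_integral => //.
  - by move=> u _; rewrite -EFinM lee_fin mulr_ge0 ?expR_ge0.
  - by apply: emeasurable_funM => //; exact: measurable_cst.
  - apply: measurable_funTS; apply/measurable_EFinP.
    exact: measurable_funM.
  - move=> u; rewrite /= in_itv/= andbT => xu.
    rewrite -!EFinM lee_fin normal_pdfE ?oner_neq0// /normal_peak /normal_fun.
    have pi2 : pi *+ 2 = 2 * pi :> R by rewrite mulr_natl.
    rewrite expr1n mul1r pi2 -/c.
    rewrite [leRHS]mulrCA ler_wpM2l// -expRD ler_expR.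
    have := mulr_ge0 (ltW x0) (etrans (subr_ge0 _ _) xu : 0 <= u - x).
    nra.
rewrite ge0_integralZl//; last 2 first.
- by apply: measurable_funTS; apply/measurable_EFinP.
- by move=> u _; rewrite lee_fin normal_pdf_ge0.
rewrite -[leRHS]mule1 lee_wpmul2l ?lee_fin ?expR_ge0//.
rewrite -(integral_normal_pdf x 1); apply: ge0_subset_integral => //.
- exact/measurable_EFinP.
- by move=> u _; rewrite lee_fin normal_pdf_ge0.
Qed.

Lemma confidence_threshold_sqr_le (eta x : R) (n : nat) : 0 < eta < 1 ->
  (2 <= n)%N -> confidence_threshold n eta x ->
  x ^+ 2 <= (4 - 2 * ln eta / ln 2) * ln n%:R.
Proof.
move=> /andP[e0 e1] n2 [x0 tail].
have n0 : 0 < n%:R :> R by rewrite ltr0n (leq_trans _ n2).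
have := gaussian_tail_le x0; rewrite tail lee_fin => le_tail.
have ln20 : 0 < ln (2 : R) by rewrite ln_gt0// ltr1n.
have ln2n : ln (2 : R) <= ln n%:R by rewrite ler_ln ?posrE// ler_nat.
have lne : ln eta <= 0 by rewrite ln_le0// ltW.
have q0 : 0 < eta / (2 * n%:R) by rewrite divr_gt0// mulr_gt0.
have : ln (eta / (2 * n%:R)) <= - (x ^+ 2 / 2).
  by rewrite -ler_expR lnK ?posrE.
rewrite lnM ?posrE ?invr_gt0 ?mulr_gt0// lnV ?posrE ?mulr_gt0//.
rewrite lnM ?posrE// => le_x.
have : ln eta / ln 2 * ln n%:R <= ln eta.
  rewrite -{2}(@divfK _ (ln (2:R)) _ (ln eta)) ?gt_eqF//.
  by rewrite ler_wnM2l// mulr_le0_ge0// invr_ge0 ltW.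
move: ln2n le_x; lra.
Qed.

End threshold.

Section optimal_sample.
Context {R : realType}.

Let diff_ge2 (n m : nat) : (n.+2 <= m)%N -> 2 <= m%:R - n%:R :> R.
Proof. by move=> nm; rewrite lerBrDr -natrD ler_nat. Qed.

Let factor_den (n m : nat) : (n.+2 <= m)%N ->
  0 < (m%:R - n%:R + 1) * (m%:R - n%:R - 1) :> R /\
  (m%:R - n%:R + 1) * (m%:R - n%:R - 1) <= m%:R ^+ 2 :> R.
Proof.
move=> /diff_ge2 nm; have n0 : 0 <= n%:R :> R by [].
by split; nra.
Qed.

(** The denominator is at most [m ^+ 2]. *)
Lemma sample_factor_ge n m : (n.+2 <= m)%N -> m%:R ^+ 2 <= sample_factor R n m.
Proof.
move=> nm; have [d0 dm] := factor_den nm.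
by rewrite /sample_factor ler_pdivlMr// (exprD _ 2 2) ler_wpM2l.
Qed.

Lemma sample_factor_double n : (2 <= n)%N ->
  sample_factor R n (2 * n) <= 64 / 3 * n%:R ^+ 2.
Proof.
move=> n2; have n2R : 2 <= n%:R :> R by rewrite ler_nat.
rewrite /sample_factor natrM.
have d0 : 0 < (2 * n%:R - n%:R + 1) * (2 * n%:R - n%:R - 1) :> R by nra.
rewrite ler_pdivrMr//.
have -> : (2 * n%:R) ^+ 4 = 16 * (n%:R ^+ 2 * n%:R ^+ 2) :> R by ring.
have : 0 <= n%:R ^+ 2 * (n%:R ^+ 2 - 4) :> R.
  by rewrite mulr_ge0 ?sqr_ge0// subr_ge0; nra.
nra.
Qed.

Let double_ge n : (2 <= n)%N -> (n.+2 <= 2 * n)%N.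
Proof. by move=> n2; rewrite mul2n -addnn -addn2 leq_add2l. Qed.

(** The optimal value of the factor is at least [m ^+ 2] and at most its value
    at [2 * n]. *)
Lemma optimal_sample_size_le n m : (2 <= n)%N ->
  optimal_sample_size R n m -> (m <= 5 * n)%N.
Proof.
move=> n2 [nm opt].
have := le_trans (sample_factor_ge nm)
  (le_trans (opt _ (double_ge n2)) (sample_factor_double n2)) => le_m.
rewrite -(ler_nat R) natrM -(@ler_pXn2r _ 2)// ?nnegrE//.
by rewrite (le_trans le_m)// exprMn ler_wpM2r ?sqr_ge0//; lra.
Qed.

(** Beyond [5 * n] the factor exceeds its value at [2 * n], so that a minimum
    over a finite range is a global one. *)
Lemma optimal_sample_size_exists n : (2 <= n)%N ->
  exists m, optimal_sample_size R n m.
Proof.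
move=> n2; have n5 : (2 * n < (5 * n).+1)%N by rewrite ltnS leq_mul2r orbT.
pose i0 := Ordinal n5.
pose Q (i : 'I_(5 * n).+1) := (n.+2 <= i)%N.
have Q0 : Q i0 by exact: double_ge.
case: (@Order.TotalTheory.arg_minP _ _ _ i0 Q (fun i => sample_factor R n i) Q0) => i Qi min_i.
exists i; split => // k nk; have [k5|k5] := ltnP k (5 * n).+1.
  exact: (min_i (Ordinal k5)).
apply: (le_trans (min_i i0 Q0)); apply: (le_trans (sample_factor_double n2)).
apply: le_trans (sample_factor_ge nk).
have : (5 * n)%:R <= k%:R :> R by rewrite ler_nat ltnW.
rewrite natrM => nk5; have n0 : 0 <= n%:R :> R by [].
nra.
Qed.

(** With [k] for [m - n], comparing [m] with the value [2 * n] gives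
    [(n + k) ^ 4 * (n ^ 2 - 1) <= 16 * n ^ 4 * (k ^ 2 - 1)], and
    [(n + k) ^ 2 = 4 * n * k + (n - k) ^ 2] turns this into a bound on
    [(n - k) ^ 2] by a multiple of [k / n]. *)
Lemma optimal_sample_size_dist n m : (2 <= n)%N ->
  optimal_sample_size R n m -> `|m%:R - (2 * n)%:R : R| <= 4.
Proof.
move=> n2 opt_m; have [nm opt] := opt_m.
have m5 := optimal_sample_size_le n2 opt_m.
have n2R : 2 <= n%:R :> R by rewrite ler_nat.
have k2 := diff_ge2 nm.
have k4 : m%:R - n%:R <= 4 * n%:R :> R.
  have : m%:R <= (5 * n)%:R :> R by rewrite ler_nat.
  rewrite natrM; lra.
have := opt _ (double_ge n2); rewrite /sample_factor natrM.
have [dm _] := factor_den nm; have [d2 _] := factor_den (double_ge n2).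
rewrite natrM in d2; rewrite ler_pdivrMr// mulrAC ler_pdivlMr//.
have -> : m%:R = n%:R + (m%:R - n%:R) :> R by ring.
move: (m%:R - n%:R) k2 k4 n2R => k; move: (n%:R : R) => N k2 k4 N2 le_opt.
have N1 : 3 / 4 * N ^+ 2 <= N ^+ 2 - 1 by nra.
have Nk0 : 0 < 8 * N * k by rewrite !mulr_gt0//; lra.
have kN : (N - k) ^+ 2 * (N ^+ 2 - 1) <= 2 * N * k.
  have d4 : 0 <= (N - k) ^+ 4 * (N ^+ 2 - 1).
    by rewrite mulr_ge0//; [rewrite (exprM _ 2 2) sqr_ge0|nra].
  have N4 : 0 <= N ^+ 4 by rewrite (exprM _ 2 2) sqr_ge0.
  rewrite -(ler_pM2l Nk0); move: le_opt d4 N4; lra.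
have dist : (N - k) ^+ 2 <= 16.
  have N20 : 0 < N ^+ 2 by rewrite exprn_gt0//; lra.
  rewrite -(ler_pM2r N20).
  have := ler_wpM2l (sqr_ge0 (N - k)) N1.
  have : N * k <= N * (4 * N) by rewrite ler_wpM2l//; lra.
  nra.
rewrite -(@ler_pXn2r _ 2)// ?nnegrE// real_normK ?num_real//.
move: dist; lra.
Qed.

Lemma optimal_sample_size_equiv (mstar : nat -> nat) :
  (forall n : nat, (2 <= n)%N -> optimal_sample_size R n (mstar n)) ->
  (fun n : nat => (mstar n)%:R : R^o) ~_\oo (fun n : nat => (2 * n)%:R : R^o).
Proof.
move=> opt; apply/eqaddoP => e e0; near=> n.
have n2 : (2 <= n)%N by near: n; exact: nbhs_infty_ge.
apply: (le_trans (optimal_sample_size_dist n2 (opt n n2))).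
rewrite ger0_norm// natrM -ler_pdivrMl//.
have : 4 / e <= n%:R by near: n; exact: nbhs_infty_ger.
rewrite mulrC => /le_trans; apply; rewrite ler_peMl// ler1n.
Unshelve. all: by end_near. Qed.

End optimal_sample.

(** * Cost and consistency bounds *)

Section essential_bound.
Context {R : realType}.

Lemma gaussian_measure_setT n : gaussian_measure n [set: n.-tuple R] = 1%E.
Proof. by rewrite gaussian_measure_stdgauss// probability_setT. Qed.

Lemma Lnormy_bound n (g : n.-tuple R -> R) :
  ('N[gaussian_measure n]_+oo[EFin \o g] < +oo)%E ->
  exists2 K : R, 0 <= K &
    ('N[gaussian_measure n]_+oo[EFin \o g] = K%:E)%E /\
    {ae gaussian_measure n, forall x, `|g x| <= K}.
Proof.
move=> Ny; have N0 := Lnorm_ge0 (gaussian_measure n) +oo%E (EFin \o g).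
have NK : ('N[gaussian_measure n]_+oo[EFin \o g] =
    (fine 'N[gaussian_measure n]_+oo[EFin \o g])%:E)%E.
  by rewrite fineK// ge0_fin_numE.
exists (fine 'N[gaussian_measure n]_+oo[EFin \o g]%E); first exact: fine_ge0.
split => //.
have := ess_sup_ge (gaussian_measure n) (abse \o (EFin \o g)).
apply: filterS => x; rewrite -lee_fin -NK => /le_trans; apply.
by rewrite unlock/= gaussian_measure_setT lte01.
Qed.

End essential_bound.

Section bounded_bounds.
Context {R : realType}.

Let C1 : R := moment_bound 1 (3 / 2).

Lemma moment_bound_ge1 : 1 <= moment_bound 1 (3 / 2) :> R.
Proof.
have z1 : (2 : R) `^ (1 - 3 / 2) < 1.
  by rewrite /powR pnatr_eq0/= expR_lt1 pmulr_llt0 ?ln_gt0 ?ltr1n//; lra.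
rewrite /moment_bound lerDl !mulr_ge0 ?expR_ge0 ?powR_ge0//.
by rewrite invr_ge0 subr_ge0 ltW.
Qed.

Let C1_ge1 : 1 <= C1 := moment_bound_ge1.

Lemma threshold_factor_gt0 (eta : R) : 0 < eta < 1 ->
  0 < 4 - 2 * ln eta / ln 2.
Proof.
move=> /andP[e0 e1]; rewrite subr_gt0 (@lt_trans _ _ 0)//.
rewrite pmulr_llt0 ?invr_gt0 ?ln_gt0 ?ltr1n// pmulr_rlt0//.
by rewrite ln_lt0// e0.
Qed.

Context {d : measure_display} {T : measurableType d} {P : probability T R}.
Context {n m : nat} (X : 'I_m -> {RV P >-> n.-tuple R}) (f : n.-tuple R -> R).

(** Each diagonal entry of the covariance is a mean squared error, at most
    [m * K ^+ 2] times the mean of a diagonal entry of the inverse Gram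
    matrix. *)
Lemma TrCov_le_bounded (K : R) :
  iid_gaussian X -> measurable_fun setT f -> (1 <= n)%N -> (n.+2 <= m)%N -> 0 <= K ->
  {ae gaussian_measure n, forall x, `|residue f (beta_bar X f) x| <= K} ->
  (TrCov X f <= (n%:R * (m%:R * K ^+ 2 * C1))%:E)%E.
Proof.
case: n X f => // n' X' f' iidX mf _ nm K0 resK.
rewrite TrCovE; apply: (@le_trans _ _ (\sum_(j < n'.+1) (m%:R * K ^+ 2 * C1)%:E)%E).
  by apply: lee_sum => j _; exact: integral_sqr_beta_sub_le.
by rewrite sumEFin sumr_const card_ord (mulr_natl _ n'.+1).
Qed.

Lemma beta_bar_sub_le_bounded (a : 'cV[R]_n) (K : R) :
  iid_gaussian X -> measurable_fun setT f -> (1 <= n)%N -> (n.+2 <= m)%N -> 0 <= K ->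
  {ae gaussian_measure n, forall x, `|residue f a x| <= K} ->
  forall j, `|beta_bar X f j 0 - a j 0| <= Num.sqrt m%:R * K * ((1 + C1) / 2).
Proof.
case: n X f a => // n' X' f' a iidX mf _ nm K0 resK j.
have le_int := integral_norm_beta_sub_le mf iidX nm K0 resK j.
pose g w := beta X' f' w j 0 - a j 0.
have ig : P.-integrable setT (EFin \o g).
  apply/integrableP; split.
    by apply/measurable_EFinP; exact: measurable_beta_sub.
  exact: (le_lt_trans le_int (ltry _)).
have intg : (\int[P]_w (g w)%:E)%E \is a fin_num by exact: integrable_fin_num.
have -> : beta_bar X' f' j 0 - a j 0 = fine (\int[P]_w (g w)%:E).
  rewrite [beta_bar _ _ _ _]mxE unlock.
  have -> : (\int[P]_w (beta X' f' w j 0)%:E =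
      \int[P]_w ((EFin \o g) w + (cst (a j 0)%:E) w))%E.
    by apply: eq_integral => w _; rewrite /= -EFinD subrK.
  rewrite integralD//; last by apply: finite_measure_integrable_cst.
  rewrite integral_cst//= [X in (_ * X)%E]probability_setT mule1.
  by rewrite fineD// addrK.
rewrite -lee_fin -abse_EFin fineK//.
by apply: le_trans le_int; exact: le_abse_integral (measurable_int _ ig).
Qed.

(** The factor [n ^+ 2 * m] of the cost of one draw times the bound [n * m] of
    [TrCov_le_bounded] leaves [n ^+ 3 * m ^+ 2], and [m ^+ 2] is at most
    [sample_factor R n m]. *)
Lemma cost_le (eta kappa x eps : R) (p : \bar R) : 0 < eta < 1 -> 0 < kappa ->
  wishart_setting X f p ->
  residue f (beta_bar X f) \in Lfun (gaussian_measure n) +oo%E ->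
  (n.+2 <= m)%N -> confidence_threshold n eta x -> 0 < eps ->
  (cost X f kappa x eps <=
    (kappa * 4 * C1 * (4 - 2 * ln eta / ln 2) * eps ^- 2 *
      (n%:R ^+ 3 * ln n%:R * sample_factor R n m))%:E *
    'N[gaussian_measure n]_+oo[EFin \o residue f (beta_bar X f)] ^+ 2)%E.
Proof.
move=> eta01 k0 [n2 nm1 iidX _ [fL _]] resL nm xP e0.
have mf : measurable_fun setT f by have := set_mem (sub_Lfun_mfun fL).
have Ny : ('N[gaussian_measure n]_+oo[EFin \o residue f (beta_bar X f)] < +oo)%E.
  by have := set_mem (sub_Lfun_finLfun resL).
have [K K0 [-> resK]] := Lnormy_bound Ny.
have TrK := TrCov_le_bounded iidX mf (ltnW n2) nm K0 resK.
have x2 := confidence_threshold_sqr_le eta01 n2 xP.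
have sf := @sample_factor_ge R _ _ nm.
have e20 : 0 < eps ^- 2 by rewrite invr_gt0 exprn_gt0.
have C0 : 0 <= C1 by rewrite (le_trans _ C1_ge1).
rewrite /cost -EFin_expe -EFinM.
apply: (@le_trans _ _ ((kappa * (n%:R ^+ 2 * m%:R))%:E *
   ((4 * x ^+ 2 * eps ^- 2)%:E * (n%:R * (m%:R * K ^+ 2 * C1))%:E))%E).
  rewrite lee_wpmul2l ?lee_fin ?mulr_ge0 ?exprn_ge0 ?(ltW k0)//.
  by rewrite lee_wpmul2l// lee_fin mulr_ge0 ?(ltW e20)// mulr_ge0 ?sqr_ge0.
rewrite -!EFinM lee_fin.
set L := 4 - 2 * ln eta / ln 2 in x2 *.
rewrite [leLHS](_ : _ = (kappa * 4 * C1 * eps ^- 2 * n%:R ^+ 3 * K ^+ 2) *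
  (x ^+ 2 * m%:R ^+ 2)); last by ring.
rewrite [leRHS](_ : _ = (kappa * 4 * C1 * eps ^- 2 * n%:R ^+ 3 * K ^+ 2) *
  ((L * ln n%:R) * sample_factor R n m)); last by ring.
apply: ler_wpM2l; last by apply: ler_pM => //; exact: sqr_ge0.
rewrite mulr_ge0 ?sqr_ge0// mulr_ge0 ?exprn_ge0// mulr_ge0 ?(ltW e20)//.
by rewrite !mulr_ge0// ltW.
Qed.

(** The mean error in each coordinate is [O(Num.sqrt m)], which is
    [O(Num.sqrt n)] as [m <= 5 * n]; summing [n] squares gives [O(n)].  An
    infinite essential supremum makes the bound trivial. *)
Lemma consistency_le (p : \bar R) (alpha : 'cV[R]_n) :
  wishart_setting X f p -> optimal_sample_size R n m ->
  ((l2norm (beta_bar X f - alpha))%:E <=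
    (3 * ((1 + C1) / 2) * n%:R)%:E *
    'N[gaussian_measure n]_+oo[EFin \o residue f alpha])%E.
Proof.
move=> [n2 nm1 iidX _ [fL _]] optm.
have mf : measurable_fun setT f by have := set_mem (sub_Lfun_mfun fL).
have c0 : 0 < 3 * ((1 + C1) / 2) * n%:R.
  rewrite !mulr_gt0 ?ltr0n ?(leq_trans _ n2)//.
  by rewrite (lt_le_trans _ (lerD (lexx 1) C1_ge1)).
have [Ny|] := ltP ('N[gaussian_measure n]_+oo[EFin \o residue f alpha])%E +oo%E; last first.
  by rewrite leye_eq => /eqP ->; rewrite gt0_muley ?leey// lte_fin.
have [K K0 [-> resK]] := Lnormy_bound Ny.
have m5 := optimal_sample_size_le n2 optm.
have [nm _] := optm.
rewrite -EFinM lee_fin.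
have le_j := beta_bar_sub_le_bounded iidX mf (ltnW n2) nm K0 resK.
set c := (1 + C1) / 2 in le_j c0 *.
have c1 : 0 <= c by rewrite divr_ge0// addr_ge0// (le_trans _ C1_ge1).
have B0 : 0 <= 3 * c * n%:R * K by rewrite mulr_ge0// ltW.
rewrite /l2norm -[leRHS]ger0_norm// -sqrtr_sqr ler_wsqrtr//.
apply: (@le_trans _ _ (\sum_(j < n) (Num.sqrt m%:R * K * c) ^+ 2)).
  apply: ler_sum => j _; rewrite [(beta_bar X f - alpha) j 0]mxE [(- alpha) _ _]mxE.
  rewrite -[leLHS]real_normK ?num_real// lerXn2r ?nnegrE//.
  by rewrite mulr_ge0// mulr_ge0.
rewrite sumr_const card_ord.
have m5R : m%:R <= 5 * n%:R :> R by rewrite -natrM ler_nat.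
rewrite [leLHS](_ : _ = m%:R * (n%:R * (K ^+ 2 * c ^+ 2))); last first.
  by rewrite !exprMn sqr_sqrtr//; ring.
rewrite [leRHS](_ : _ = (9 * n%:R) * (n%:R * (K ^+ 2 * c ^+ 2))); last by ring.
apply: ler_wpM2r; first by rewrite mulr_ge0// mulr_ge0 ?sqr_ge0.
by apply: (le_trans m5R); rewrite ler_wpM2r// ler_nat.
Qed.

End bounded_bounds.

Theorem propositionB3 (R : realType) :
  (* finiteness of Tr(Cov(beta)) *)
  (forall (d : measure_display) (T : measurableType d) (P : probability T R)
      (n m : nat) (X : 'I_m -> {RV P >-> n.-tuple R}) (f : n.-tuple R -> R)
      (p : \bar R),
    wishart_setting X f p ->
    n%:R + exponent_ratio p < m%:R :> R ->
    (TrCov X f < +oo)%E) /\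
  (* the condition for p = +oo *)
  (forall n m : nat,
    n%:R + exponent_ratio (+oo%E : \bar R) < m%:R :> R <-> (n.+2 <= m)%N) /\
  (* cost bound *)
  (forall eta kappa : R, 0 < eta < 1 -> 0 < kappa ->
    exists2 C : R, 0 < C &
    forall (d : measure_display) (T : measurableType d) (P : probability T R)
      (n m : nat) (X : 'I_m -> {RV P >-> n.-tuple R}) (f : n.-tuple R -> R)
      (p : \bar R) (x eps : R),
    wishart_setting X f p ->
    residue f (beta_bar X f) \in Lfun (gaussian_measure n) +oo%E ->
    (n.+2 <= m)%N -> confidence_threshold n eta x -> 0 < eps ->
    (cost X f kappa x eps <=
      (C * eps ^- 2 *
        (n%:R ^+ 3 * m%:R ^+ 4 * ln n%:R /
          ((m%:R - n%:R + 1) * (m%:R - n%:R - 1))))%:E *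
      'N[gaussian_measure n]_+oo[EFin \o residue f (beta_bar X f)] ^+ 2)%E) /\
  (* the optimal m *)
  (forall n : nat, (2 <= n)%N -> exists m : nat, optimal_sample_size R n m) /\
  (forall mstar : nat -> nat,
    (forall n : nat, (2 <= n)%N -> optimal_sample_size R n (mstar n)) ->
    (fun n : nat => (mstar n)%:R : R^o) ~_\oo
    (fun n : nat => (2 * n)%:R : R^o)) /\
  (* cost bound for the optimal m *)
  (forall eta kappa : R, 0 < eta < 1 -> 0 < kappa ->
    exists2 C' : R, 0 < C' &
    forall (d : measure_display) (T : measurableType d) (P : probability T R)
      (n m : nat) (X : 'I_m -> {RV P >-> n.-tuple R}) (f : n.-tuple R -> R)
      (p : \bar R) (x eps : R),
    wishart_setting X f p ->
    residue f (beta_bar X f) \in Lfun (gaussian_measure n) +oo%E ->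
    optimal_sample_size R n m -> confidence_threshold n eta x -> 0 < eps ->
    (cost X f kappa x eps <=
      (C' * eps ^- 2 * (n%:R ^+ 5 * ln n%:R))%:E *
      'N[gaussian_measure n]_+oo[EFin \o residue f (beta_bar X f)] ^+ 2)%E) /\
  (* consistency error for the optimal m *)
  (exists2 C'' : R, 0 < C'' &
    forall (d : measure_display) (T : measurableType d) (P : probability T R)
      (n m : nat) (X : 'I_m -> {RV P >-> n.-tuple R}) (f : n.-tuple R -> R)
      (p : \bar R) (alpha : 'cV[R]_n),
    wishart_setting X f p ->
    optimal_sample_size R n m -> least_squares f alpha ->
    ((l2norm (beta_bar X f - alpha))%:E <=
      (C'' * n%:R)%:E *
      'N[gaussian_measure n]_+oo[EFin \o residue f alpha])%E).

Proof.
split; [|split; [|split; [|split; [|split; [|split]]]]].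
- move=> d T P [|n] m X f p [n2 nm iidX p2 [fL resL]] // le_m.
  have mf : measurable_fun setT f by have := set_mem (sub_Lfun_mfun fL).
  case: p p2 fL resL le_m => [r||] //= p2 fL resL le_m.
    by apply: (TrCov_lty mf iidX _ resL le_m); rewrite lte_fin in p2.
  have nm2 : (n.+3 <= m)%N by rewrite -(ltr_nat R) -natr1.
  have Ny : ('N[gaussian_measure n.+1]_+oo[EFin \o residue f (beta_bar X f)] < +oo)%E.
    by have := set_mem (sub_Lfun_finLfun resL).
  have [K K0 [_ resK]] := Lnormy_bound Ny.
  exact: (le_lt_trans (TrCov_le_bounded iidX mf _ nm2 K0 resK) (ltry _)).
- by move=> n m /=; rewrite natr1 ltr_nat.
- move=> eta kappa eta01 k0.
  have M0 : 0 < moment_bound 1 (3 / 2) :> R := lt_le_trans ltr01 moment_bound_ge1.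
  exists (kappa * 4 * moment_bound 1 (3 / 2) * (4 - 2 * ln eta / ln 2)).
    by rewrite mulr_gt0 ?threshold_factor_gt0// !mulr_gt0.
  move=> d T P n m X f p x eps setting resL nm xP e0.
  have -> : n%:R ^+ 3 * m%:R ^+ 4 * ln n%:R /
      ((m%:R - n%:R + 1) * (m%:R - n%:R - 1)) =
      n%:R ^+ 3 * ln n%:R * sample_factor R n m.
    by rewrite /sample_factor; ring.
  exact: cost_le setting resL nm xP e0.
- exact: optimal_sample_size_exists.
- exact: optimal_sample_size_equiv.
- move=> eta kappa eta01 k0.
  have M0 : 0 < moment_bound 1 (3 / 2) :> R := lt_le_trans ltr01 moment_bound_ge1.
  have C0 : 0 < kappa * 4 * moment_bound 1 (3 / 2) * (4 - 2 * ln eta / ln 2).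
    by rewrite mulr_gt0 ?threshold_factor_gt0// !mulr_gt0.
  exists (kappa * 4 * moment_bound 1 (3 / 2) * (4 - 2 * ln eta / ln 2) * (64 / 3)).
    by rewrite mulr_gt0.
  move=> d T P n m X f p x eps setting resL optm xP e0.
  have n2 : (2 <= n)%N by case: setting.
  have ln0 : 0 <= ln n%:R :> R by rewrite ln_ge0// ler1n (leq_trans _ n2).
  apply: (le_trans (cost_le eta01 k0 setting resL (proj1 optm) xP e0)).
  rewrite lee_wpmul2r ?expe_ge0 ?Lnorm_ge0// lee_fin.
  move: C0; move: (_ * (4 - _)) => C C0.
  rewrite [leRHS](_ : _ = C * eps ^- 2 *
    (n%:R ^+ 3 * ln n%:R * (64 / 3 * n%:R ^+ 2))); last by ring.
  rewrite ler_wpM2l ?mulr_ge0 ?(ltW C0) ?invr_ge0 ?exprn_ge0 ?(ltW e0)//.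
  rewrite ler_wpM2l ?mulr_ge0 ?exprn_ge0//.
  have [nm opt] := optm; apply: le_trans (sample_factor_double n2).
  by apply: opt; rewrite mul2n -addnn -addn2 leq_add2l.
- have M0 : 0 < 1 + moment_bound 1 (3 / 2) :> R.
    by rewrite addr_gt0// (lt_le_trans _ moment_bound_ge1).
  exists (3 * ((1 + moment_bound 1 (3 / 2)) / 2)); first by rewrite mulr_gt0// divr_gt0.
  move=> d T P n m X f p alpha setting optm _.
  exact: consistency_le setting optm.
Qed.
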